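(* Let $X$ be a Kaplansky module over $C(K)$, let $U$ be a $d$-isomorphism of $X$ with $\sigma(U)\subseteq\mathbb{T}$ (the unit circle), let $w\in C(K)$ and $T=wU$. Let $\varphi$ be the homeomorphism of $K$ corresponding to the automorphism $f\mapsto UfU^{-1}$ of $C(K)$, i.e. $UfU^{-1}=f\circ\varphi$. Assume that the set of all $\varphi$-periodic points in $K$ is empty and that $K$ has no isolated points. Then $$\sigma_2(T)=\sigma_{a.p.}(T).$$
   Context: All spaces are over $\mathbb{C}$; $L(X)$ is the algebra of bounded linear operators on $X$. Banach $C(K)$-module: $K$ is a compact Hausdorff space, $X$ a Banach space, $m:C(K)\to L(X)$ a bounded unital homomorphism. It is always assumed that $m$ is injective and isometric and that $m(C(K))$ is closed in $L(X)$ in the weak operator topology; $f\in C(K)$ is identified with $m(f)$. For $x\in X$ the cyclic subspace $X(x)=\mathrm{cl}\{fx: f\in C(K)\}$, with the norm of $X$ and the cone $X_+(x)=\mathrm{cl}\{fx: f\in C(K), f\ge0\}$, is a (complex) Banach lattice. $X$ is a Kaplansky module if $K$ is extremally disconnected and for every $x$ the set $\{f\in C(K): fx=0\}$ is a band in $C(K)$. $d$-endomorphism: $T\in L(X)$ such that for every $x\in X$, $T(X(x))\subseteq X(Tx)$ and $T|X(x):X(x)\to X(Tx)$ is disjointness preserving ($u\perp v\Rightarrow Tu\perp Tv$). A $d$-isomorphism is an invertible $d$-endomorphism whose inverse is also a $d$-endomorphism. A point $k$ is $\varphi$-periodic if $\varphi^m(k)=k$ for some $m\in\mathbb{N}$.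 $\sigma_{a.p.}(A)=\{\lambda\in\mathbb{C}:\exists x_n,\ \|x_n\|=1,\ Ax_n-\lambda x_n\to0\}$. $\sigma_2(A)$ is the set of $\lambda\in\mathbb{C}$ for which $\lambda I-A$ is not upper semi-Fredholm (upper semi-Fredholm: closed range and finite-dimensional kernel). *)

(* Defs.v *)
From HB Require Import structures.
From mathcomp Require Import all_boot all_order all_algebra.
From mathcomp Require Import all_classical all_reals all_analysis.
From mathcomp.real_closed Require Import complex.

Set Implicit Arguments.
Unset Strict Implicit.
Unset Printing Implicit Defensive.

Import Order.TTheory GRing.Theory Num.Theory.
Import numFieldNormedType.Exports.

Local Open Scope classical_set_scope.
Local Open Scope ring_scope.
Local Open Scope complex_scope.

(** [R[i]] itself carries no topology; its alias [R[i]^o] is the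
    one-dimensional normed space, with the topology of the modulus. *)
Notation CC R := ((R[i])^o) (only parsing).

(** The algebra [C(K)] of complex continuous functions, as the library's
    bundled type, closed under the pointwise operations. *)
Notation CK R K := (continuousType K (CC R)).

Section ContinuousAlgebra.
Variables (R : realType) (K : topologicalType).

Lemma continuous_add_fun (f g : CK R K) : continuous (f \+ g).
Proof.
by move=> k; apply: (@cvgD _ (CC R) K (nbhs k) _ f g); exact: cts_fun.
Qed.

HB.instance Definition _ (f g : CK R K) :=
  isContinuous.Build K (CC R) (f \+ g) (@continuous_add_fun f g).

Lemma continuous_mul_fun (f g : CK R K) : continuous (f \* g).
Proof.
move=> k; apply: (@cvgZ _ (CC R) K (nbhs k) _ (f : K -> CC R) g);
  exact: cts_fun.
Qed.

HB.instance Definition _ (f g : CK R K) :=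
  isContinuous.Build K (CC R) (f \* g) (@continuous_mul_fun f g).

Lemma continuous_scale_fun (a : R[i]) (f : CK R K) : continuous (a \*: f).
Proof.
by move=> k; apply: (@cvgZl_tmp _ (CC R) K (nbhs k) _ a f); exact: cts_fun.
Qed.

HB.instance Definition _ (a : R[i]) (f : CK R K) :=
  isContinuous.Build K (CC R) (a \*: f) (@continuous_scale_fun a f).

End ContinuousAlgebra.

(** Continuous (equivalently, bounded) linear maps between normed spaces. *)
#[short(type="boundedLinearType")]
HB.structure Definition BoundedLinear (F : numFieldType)
    (V W : normedModType F) :=
  {f of @GRing.Linear F V W *:%R f & @Continuous V W f}.

HB.instance Definition _ (F : numFieldType) (V W : normedModType F) :=
  gen_eqMixin (boundedLinearType V W).
HB.instance Definition _ (F : numFieldType) (V W : normedModType F) :=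
  gen_choiceMixin (boundedLinearType V W).

Notation LX X := (boundedLinearType X X).

Section Operators.
Variables (R : realType) (X : normedModType R[i]).

Definition dual := boundedLinearType X (CC R).

(** Weak operator topology: the coarsest one making all the functionals
    [A |-> l (A x)] continuous. *)
Definition wot_eval (A : LX X) : {ptws X * dual -> CC R} :=
  fun p => p.2 (A p.1).

Definition wot := initial_topology wot_eval.

(** Norms of an [R[i]]-normed space are nonnegative reals seen in [R[i]];
    [complex.Re] brings them back to [R]. *)
Definition opnorm (A : X -> X) : R :=
  sup [set complex.Re `|A x| | x in [set x : X | `|x| <= 1]].

Definition inverse_ops (A B : X -> X) := cancel A B /\ cancel B A.

Definition invertible_op (A : X -> X) := exists B : LX X, inverse_ops A B.

(** [shift_op l A] is [l I - A]. *)
Definition shift_op (l : R[i]) (A : X -> X) : X -> X := fun x => l *: x - A x.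

Definition spectrum (A : X -> X) : set R[i] :=
  [set l | ~ invertible_op (shift_op l A)].

Definition sigma_ap (A : X -> X) : set R[i] :=
  [set l | exists x : nat -> X, (forall n, `|x n| = 1) /\
     (fun n => A (x n) - l *: x n) @ \oo --> (0 : X)].

Definition finite_dim (V : set X) :=
  exists (n : nat) (e : 'I_n -> X),
    V = [set \sum_(i < n) c i *: e i | c in [set: 'I_n -> R[i]]].

Definition upper_semi_fredholm (A : X -> X) :=
  closed (range A) /\ finite_dim [set x | A x = 0].

Definition sigma_2 (A : X -> X) : set R[i] :=
  [set l | ~ upper_semi_fredholm (shift_op l A)].

End Operators.

Section FunctionLattice.
Variables (R : realType) (K : topologicalType).

Definition supnorm (f : K -> CC R) : R :=
  sup [set complex.Re `|f k| | k in [set: K]].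

(** The order of [R[i]] is [z <= w] iff [w - z] is a nonnegative real. *)
Definition fun_le (f g : K -> CC R) := forall k, (f k : R[i]) <= g k.

Definition fun_real (f : K -> CC R) := forall k, (f k : R[i]) \is Num.real.

Definition fun_lub (D : set (CK R K)) (s : CK R K) :=
  [/\ fun_real s, forall f, D f -> fun_le f s &
      forall t : CK R K,
        fun_real t -> (forall f, D f -> fun_le f t) -> fun_le s t].

(** Bands of the complex vector lattice [C(K)]: solid linear subspaces
    containing the suprema (in the real part of [C(K)]) of their sets of
    real-valued elements. *)
Definition band (B : set (CK R K)) :=
  [/\ B (cst 0 : CK R K),
      forall (a : R[i]) (f g : CK R K),
        B f -> B g -> B ((a \*: f) \+ g : CK R K),
      forall f g : CK R K, B f -> (forall k, `|g k| <= `|f k|) -> B g &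
      forall (D : set (CK R K)) (s : CK R K),
        D `<=` B -> D `<=` [set f : CK R K | fun_real f] ->
        fun_lub D s -> B s].

Definition extremally_disconnected := forall A : set K, open A ->
  open (closure A).

End FunctionLattice.

Section Modules.
Variables (R : realType) (K : topologicalType) (X : normedModType R[i]).

Record banach_module (m : CK R K -> LX X) : Prop := BanachModule {
  module_add : forall (f g : CK R K) (x : X),
    m (f \+ g : CK R K) x = m f x + m g x ;
  module_scale : forall (a : R[i]) (f : CK R K) (x : X),
    m (a \*: f : CK R K) x = a *: m f x ;
  module_mul : forall (f g : CK R K) (x : X),
    m (f \* g : CK R K) x = m f (m g x) ;
  module_one : forall x : X, m (cst 1 : CK R K) x = x ;
  module_inj : injective m ;
  module_isometric : forall f : CK R K, opnorm (m f) = supnorm f ;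
  module_wot_closed : closed (range m : set (wot X))
}.

Variable m : CK R K -> LX X.

Definition kaplansky_module :=
  [/\ banach_module m, extremally_disconnected K &
      forall x : X, band [set f : CK R K | m f x = 0]].

Definition cyclic (x : X) : set X := closure [set m f x | f in [set: CK R K]].

Definition cyclic_pos (x : X) : set X :=
  closure [set m f x | f in [set f : CK R K | fun_le (cst 0) f]].

Definition cyclic_le (x u v : X) := cyclic_pos x (v - u).

(** The real Banach lattice of which [cyclic x] is the complexification. *)
Definition cyclic_real (x : X) : set X :=
  [set u - v | u in cyclic_pos x & v in cyclic_pos x].

Definition cyclic_lub (x : X) (D : set X) (s : X) :=
  [/\ cyclic_real x s, forall d, D d -> cyclic_le x d s &
      forall t, cyclic_real x t -> (forall d, D d -> cyclic_le x d t) ->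
        cyclic_le x s t].

Definition cyclic_glb (x : X) (D : set X) (s : X) :=
  [/\ cyclic_real x s, forall d, D d -> cyclic_le x s d &
      forall t, cyclic_real x t -> (forall d, D d -> cyclic_le x t d) ->
        cyclic_le x t s].

(** In the complexification of a real Banach lattice,
    [|u + i v| = sup_t (cos t u + sin t v)]. *)
Definition cyclic_modulus (x z a : X) :=
  exists u v : X, [/\ cyclic_real x u, cyclic_real x v, z = u + 'i *: v &
    cyclic_lub x
      [set (cos t)%:C *: u + (sin t)%:C *: v | t in [set: R]] a].

(** [u] and [v] are disjoint when the infimum of [|u|] and [|v|] is [0]. *)
Definition cyclic_disjoint (x u v : X) :=
  exists a b : X, [/\ cyclic_modulus x u a, cyclic_modulus x v b &
    cyclic_glb x [set a; b] 0].

Definition d_endomorphism (T : LX X) :=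
  forall x : X, T @` cyclic x `<=` cyclic (T x) /\
    forall u v : X, cyclic x u -> cyclic x v ->
      cyclic_disjoint x u v -> cyclic_disjoint (T x) (T u) (T v).

(** [V] is the inverse of [U]. *)
Definition d_isomorphism (U V : LX X) :=
  [/\ d_endomorphism U, d_endomorphism V & inverse_ops U V].

End Modules.

Definition homeomorphism (K : topologicalType) (phi : continuousType K K) :=
  exists psi : continuousType K K, cancel phi psi /\ cancel psi phi.

Definition periodic_points (K : Type) (phi : K -> K) : set K :=
  [set k | exists n : nat, (0 < n)%N /\ iter n phi k = k].

(* Main.v *)
(** If [l] is not an approximate eigenvalue, [l I - T] is bounded below, hence
    upper semi-Fredholm. Conversely let [l] be an approximate eigenvalue and
    suppose that [l I - T] is upper semi-Fredholm. By the open mapping theorem it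
    has a nonzero kernel vector [x], and every [y] lies within [C |(l I - T) y|] of
    the finite-dimensional kernel. As [T (f x) = l (f o phi) x], a function [g] that
    varies slowly along [phi] makes [g x] an approximate kernel vector; so there
    cannot be more than [dim ker] such functions with disjoint supports.

    Slow functions come from towers over a clopen set [F]: put the weight [Q ^ -|i|]
    on [phi ^ i F], [|i| <= n], with [Q] close to [1]. The error at the ends is
    negligible unless the size [|1_F x|] of [F] grows substantially under [phi ^ n]
    or [phi ^ -n]. Since these sizes are bounded by [|x|], doubling cannot
    go on forever. Hence, but for finitely many points [P] near which good towers
    exist, sizes are exponentially small: [|1_A x| <= C / 2 ^ L] when [A] avoids the
    first [L] steps of the orbits of [P]. Then sizes do not tend to [0] at some
    point [k1] of these orbits. For suitable clopen [E_L] shrinking to [k1], the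
    [1_(E_L) x] converge geometrically to some [y <> 0], which vanishes on every clopen
    set missing [k1]. As the annihilator of [y] is a band, this makes [k1] an
    isolated point. *)

Require Import Defs.
From mathcomp Require Import all_boot all_order all_algebra.
From mathcomp Require Import all_classical all_reals all_analysis.
From mathcomp.real_closed Require Import complex.
From mathcomp Require Import zify ring lra.

Set Implicit Arguments.
Unset Strict Implicit.
Unset Printing Implicit Defensive.

Import Order.TTheory GRing.Theory Num.Theory.
Import numFieldNormedType.Exports.

Local Open Scope classical_set_scope.
Local Open Scope ring_scope.

(** * Clopen sets *)

Section ClopenSets.
Context {K : topologicalType}.

Lemma clopen_forall_seq (I : eqType) (s : seq I) (A : I -> set K) :
  (forall i, clopen (A i)) -> clopen [set z | forall i, i \in s -> A i z].
Proof.
move=> cA; elim: s => [|i s IHs].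
  suff -> : [set z | forall i, i \in [::] -> A i z] = setT by exact: clopenT.
  by rewrite predeqE => z; split.
suff -> : [set z | forall j, j \in i :: s -> A j z] =
    A i `&` [set z | forall j, j \in s -> A j z] by exact: clopenI.
rewrite predeqE => z; split=> [H|[Ai H] j].
  by split=> [|j js]; apply: H; rewrite inE ?eqxx ?js ?orbT.
by rewrite inE => /predU1P[->|/H].
Qed.

Lemma clopen_forall_lt (N : nat) (A : nat -> set K) :
  (forall i, clopen (A i)) -> clopen [set z | forall i, (i < N)%N -> A i z].
Proof.
move=> cA; have := clopen_forall_seq (iota 0 N) cA.
by congr clopen; rewrite predeqE => z; split=> H i;
  have := H i; rewrite mem_iota /= add0n.
Qed.

Lemma clopen_bigsetU (F : nat -> set K) (a b : nat) :
  (forall i, clopen (F i)) -> clopen (\big[setU/set0]_(a <= i < b) F i).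
Proof.
by move=> cF; elim/big_ind: _ => [|A B|i _]; [exact: clopen0|exact: clopenU|].
Qed.

Lemma in_bigsetU (T : Type) (F : nat -> set T) (a b : nat) (k : T) :
  (\big[setU/set0]_(a <= i < b) F i) k <-> exists2 i, (a <= i < b)%N & F i k.
Proof.
rewrite -bigcup_seq; split=> -[i /=]; rewrite ?mem_index_iota => ab Fi.
  by exists i.
by exists i; rewrite /= ?mem_index_iota.
Qed.

Lemma clopenD (A B : set K) : clopen A -> clopen B -> clopen (A `\` B).
Proof. by move=> cA cB; rewrite setDE; apply: clopenI => //; apply: clopenC cB. Qed.

Lemma clopen_iter (f : K -> K) (n : nat) (A : set K) :
  continuous f -> clopen A -> clopen (iter n f @^-1` A).
Proof.
move=> cf cA; apply: preimage_clopen => //.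
elim: n => [|n IHn] /= k; first exact: cvg_id.
by apply: continuous_comp; [exact: IHn|exact: cf].
Qed.

Hypothesis compactK : compact [set: K].

(* The complements of the finitely coverable sets form a filter, which has no
   cluster point, so it is not proper. *)
Lemma clopen_finite_cover (P : set K -> Prop) :
  (forall k, exists A, [/\ clopen A, A k & P A]) ->
  exists (N : nat) (F : nat -> set K),
    (forall i, clopen (F i)) /\ (forall i, (i < N)%N -> P (F i)) /\
    forall k, exists2 i, (i < N)%N & F i k.
Proof.
move=> Pcov.
pose cov (s : seq (set K)) (B : set K) := (forall A, A \in s -> clopen A /\ P A)
  /\ forall k, ~ B k -> exists2 A, A \in s & A k.
pose FF : set_system K := [set B | exists s, cov s B].
have FFf : Filter FF.
  split=> [|A B [s [sP sA]] [t [tP tB]]|A B AB [s [sP sA]]].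
  - by exists [::]; split=> // k; case.
  - exists (s ++ t); split=> [C|k].
      by rewrite mem_cat => /orP[/sP|/tP].
    move=> /not_andP[/sA[C Cs Ck]|/tB[C Cs Ck]]; exists C => //.
      by rewrite mem_cat Cs.
    by rewrite mem_cat Cs orbT.
  - by exists s; split=> // k nB; apply: sA => /AB.
have [[s [sP s0]]|n0] := EM (FF set0).
  exists (size s), (nth setT s); split=> [i|]; last (split=> [i il|k]).
  - have [il|?] := ltnP i (size s); first by have [] := sP _ (mem_nth setT il).
    by rewrite nth_default //; exact: clopenT.
  - by have [] := sP _ (mem_nth setT il).
  - by have [//|A As Ak] := s0 k; exists (index A s); rewrite ?index_mem ?nth_index.
have FFp : ProperFilter FF by split.
have [k [_ clk]] := compactK FFp (filterT).
have [A [cA Ak PA]] := Pcov k.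
have FA : FF (~` A).
  exists [:: A]; split=> [B|l /contrapT Al]; first by rewrite inE => /eqP->.
  by exists A; rewrite ?inE.
have nA : nbhs k A by apply: open_nbhs_nbhs; split=> //; case: cA.
by have [l []] := clk _ _ FA nA.
Qed.

Hypothesis base : forall (k : K) (O : set K), open O -> O k ->
  exists A, [/\ clopen A, A k & A `<=` O].
Hypothesis hausK : hausdorff_space K.

Lemma clopen_neighbourhood (k l : K) : k <> l ->
  exists A : set K, [/\ clopen A, A k & ~ A l].
Proof.
move=> kl; have [|A [cA Ak Al]] := @base k (~` [set l]) _ kl.
  by apply: closed_openC; apply: accessible_closed_set1; exact: hausdorff_accessible.
by exists A; split=> // /Al; apply.
Qed.

(** With [A (p, q)] containing [p] and not [q], the cell of [p] lies in [A (p, q)] and off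
    [A (q, p)], and the cell of [q] the other way round; so the two cells are disjoint. *)
Lemma clopen_separation (s : seq K) : exists V : K -> set K,
  (forall p, clopen (V p)) /\ (forall p, V p p) /\
  forall p q z, p \in s -> q \in s -> V p z -> V q z -> p = q.
Proof.
have /choice[A AP] (pq : K * K) : exists A, clopen A /\
    (pq.1 <> pq.2 -> A pq.1 /\ ~ A pq.2).
  have [E|E] := EM (pq.1 = pq.2); first by exists setT; split; [exact: clopenT|].
  by have [A [? ? ?]] := clopen_neighbourhood E; exists A.
pose W p q := if q == p then setT else A (p, q) `&` ~` A (q, p).
exists (fun p => [set z | forall q, q \in s -> W p q z]).
split=> [p|]; last split=> [p q _|p q z ps qs /(_ q qs) + /(_ p ps)].
- apply: clopen_forall_seq => q; rewrite /W; case: ifP => _; first exact: clopenT.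
  have [? _] := AP (p, q); have [? _] := AP (q, p).
  by apply: clopenI => //; exact: (@clopenC _ _ set0).
- rewrite /W; case: eqP => // qp.
  by split; [have [_ /=[|//]] := AP (p, q); exact: nesym|have [_ []] := AP (q, p)].
- rewrite /W (eq_sym q); case: eqP => // pq [? _] [? nA].
  by case: nA.
Qed.

End ClopenSets.

(** * Towers of an aperiodic homeomorphism *)

Section Towers.
Context {R : realType} {K : topologicalType}.
Variables (phi psi : K -> K).
Hypotheses (compactK : compact [set: K]) (hausK : hausdorff_space K).
Hypothesis base : forall (k : K) (O : set K), open O -> O k ->
  exists A, [/\ clopen A, A k & A `<=` O].
Hypotheses (cphi : continuous phi) (cpsi : continuous psi).
Hypotheses (phiK : cancel phi psi) (psiK : cancel psi phi).
Hypothesis aperiodic : forall n k, (0 < n)%N -> iter n phi k <> k.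

Lemma iter_cancel (f g : K -> K) n : cancel f g -> cancel (iter n f) (iter n g).
Proof. by move=> fK; elim: n => [|n IHn] k //; rewrite iterSr (iterS n f) fK IHn. Qed.

Lemma iter_phi_add s t k : iter s phi (iter t phi k) = iter t phi (iter s phi k).
Proof. by rewrite -!iterD addnC. Qed.

Lemma iter_psi_phi s t k : iter s psi (iter t phi k) = iter t phi (iter s psi k).
Proof.
apply: (can_inj (iter_cancel s phiK)).
by rewrite (iter_cancel s psiK) iter_phi_add (iter_cancel s psiK).
Qed.

(** No preimage of [A] under the first [N] iterates meets one of [B]: functions living on the two
    towers of height [N] have disjoint supports. *)
Definition tower_disjoint (N : nat) (A B : set K) := forall s t k,
  (s < N)%N -> (t < N)%N -> A (iter s phi k) -> ~ B (iter t phi k).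

(** This makes [A] the base of a Rokhlin tower of height [N]. *)
Definition wandering (N : nat) (A : set K) := forall s k,
  (0 < s < N)%N -> A k -> ~ A (iter s phi k).

Lemma tower_disjointS (N : nat) (A B A' B' : set K) :
  A `<=` A' -> B `<=` B' -> tower_disjoint N A' B' -> tower_disjoint N A B.
Proof. by move=> AA BB D s t k sN tN /AA As /BB; exact: (D s t k). Qed.

Lemma wandering_tower_disjoint (N : nat) (F A B : set K) : wandering N F ->
  A `<=` F -> B `<=` F -> A `&` B `<=` set0 -> tower_disjoint N A B.
Proof.
move=> wF AF BF AB s t k sN tN As Bt; case: (ltngtP s t) => st.
- apply: (@wF (t - s)%N (iter s phi k)); [lia|exact: AF|].
  by rewrite -iterD subnK ?(ltnW st) //; exact: BF.
- apply: (@wF (s - t)%N (iter t phi k)); [lia|exact: BF|].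
  by rewrite -iterD subnK ?(ltnW st) //; exact: AF.
- by apply: (AB (iter s phi k)); split=> //; rewrite st.
Qed.

(** [G k] consists of the points whose first [N] iterates follow those of [k] through separating
    cells. If [iter i phi z] is in [G k] and [iter j phi z] in [G l], the iterate of [z] of order
    [i + j] lies in the cells of [iter j phi k] and of [iter i phi l], which must then coincide. *)
Lemma tower_neighbourhoods (N : nat) (s : seq K) :
  exists G : K -> set K, (forall k, clopen (G k) /\ G k k) /\
    forall k l, k \in s -> l \in s ->
      (forall i j, (i < N)%N -> (j < N)%N -> iter i phi k <> iter j phi l) ->
      tower_disjoint N (G k) (G l).
Proof.
have [V [cV [Vp VE]]] := clopen_separation base hausK
  [seq iter i phi k | k <- s, i <- iota 0 N].
exists (fun k => [set z | forall i, (i < N)%N -> V (iter i phi k) (iter i phi z)]).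
split=> [k|k l ks ls kl i j z iN jN Gi Gj].
  split=> [|i _]; last exact: Vp.
  apply: (@clopen_forall_lt K N (fun i => iter i phi @^-1` V (iter i phi k))) => i.
  exact: clopen_iter.
apply: (kl j i) => //; apply: VE (Gi j jN) _.
- by apply/allpairsP; exists (k, j); rewrite mem_iota.
- by apply/allpairsP; exists (l, i); rewrite mem_iota.
- by rewrite /= iter_phi_add; exact: Gj.
Qed.

(** With cells as above, if [z] and [iter i phi z] both follow [k], then [iter i phi z] is in the
    cells of [iter i phi k] and of [k], so that [k] would be periodic. *)
Lemma wandering_neighbourhood (N : nat) (k : K) :
  exists A, [/\ clopen A, A k & wandering N A].
Proof.
have [V [cV [Vp VE]]] := clopen_separation base hausK
  [seq iter i phi k | i <- iota 0 N].
exists [set z | forall i, (i < N)%N -> V (iter i phi k) (iter i phi z)].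
split=> [|i _ //|i z /andP[i0 iN] Gz Gi].
  apply: (@clopen_forall_lt K N (fun i => iter i phi @^-1` V (iter i phi k))) => i.
  exact: clopen_iter.
have N0 : (0 < N)%N by lia.
apply: (@aperiodic i k i0); apply: VE (Gz i iN) (Gi 0 N0).
  by apply/mapP; exists i; rewrite ?mem_iota.
by apply/mapP; exists 0; rewrite ?mem_iota.
Qed.

(** * Growth of a monotone subadditive size along orbits *)

Variable rho : set K -> R.
Hypothesis rho_set0 : rho set0 = 0.
Hypothesis rho_mono : forall A B, clopen A -> clopen B -> A `<=` B ->
  rho A <= rho B.
Hypothesis rhoU : forall A B, clopen A -> clopen B ->
  rho (A `|` B) <= rho A + rho B.

Lemma rho_bigsetU (F : nat -> set K) N : (forall i, clopen (F i)) ->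
  rho (\big[setU/set0]_(0 <= i < N) F i) <= \sum_(0 <= i < N) rho (F i).
Proof.
move=> cF; elim: N => [|N IHN]; first by rewrite !big_geq // rho_set0.
rewrite !big_nat_recr //=; apply: le_trans (rhoU _ _) _ => //.
  exact: clopen_bigsetU.
by rewrite lerD2r.
Qed.

(* Cutting the sequence greedily, each block of light sets stays below
   [2 * tau]. *)
Lemma heavy_blocks (F : nat -> set K) (N : nat) (tau : R) :
  0 < tau -> (forall i, clopen (F i)) -> trivIset setT F ->
  (forall i, (i < N)%N -> rho (F i) < tau) ->
  forall r a, (tau *+ 2) *+ r <= rho (\big[setU/set0]_(a <= i < N) F i) ->
  exists G : nat -> set K, forall i, (i < r)%N ->
    [/\ clopen (G i), G i `<=` \big[setU/set0]_(a <= i < N) F i, tau <= rho (G i) &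
      forall j, (j < r)%N -> i <> j -> G i `&` G j `<=` set0].
Proof.
move=> tau0 cF tF light; elim=> [|r IHr] a big; first by exists (fun=> set0).
pose U a b := \big[setU/set0]_(a <= i < b) F i.
have cU b c : clopen (U b c) by exact: clopen_bigsetU.
have Ur b : (tau *+ 2) *+ r.+1 <= rho (U a N) ->
  rho (U a b) < tau *+ 2 -> rho (U a N) <= rho (U a b) + rho (U b N) ->
  (tau *+ 2) *+ r <= rho (U b N) by rewrite mulrS => ? ? ?; lra.
have tauN : tau <= rho (U a N).
  apply: le_trans big; rewrite -mulrnA mulrS lerDl mulrn_wge0 //; exact: ltW.
have ex : exists b, (a <= b <= N)%N && (tau <= rho (U a b)).
  exists N; rewrite tauN leqnn !andbT; case: leqP => // Na.
  by move: tauN; rewrite /U big_geq ?rho_set0 ?(ltnW Na) // => ?; lra.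
case: (ex_minnP ex) => b /andP[/andP[ab bN] tb] minb.
have ab' : (a < b)%N.
  rewrite ltn_neqAle ab andbT; apply/eqP => ab'; move: tb.
  by rewrite ab' /U big_geq // rho_set0; lra.
have b2 : rho (U a b) < tau *+ 2.
  have eb : b = b.-1.+1 by lia.
  rewrite eb /U big_nat_recr /=; last by lia.
  apply: le_lt_trans (rhoU _ _) _ => //; first exact: cU.
  rewrite mulr2n ltrD //; last by apply: light; lia.
  rewrite ltNge; apply/negP => tb'.
  by have := minb b.-1; rewrite tb' andbT; lia.
have UaN : U a N = U a b `|` U b N by rewrite /U (big_cat_nat ab bN).
have [|G GP] := IHr b.
  by apply: Ur => //; rewrite UaN; exact: rhoU.
exists (fun i => if i is i'.+1 then G i' else U a b).
have disj : U a b `&` U b N `<=` set0.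
  move=> k [/in_bigsetU[i iab Fi] /in_bigsetU[j jbN Fj]].
  have : i = j by apply: (tF i j) => //; exists k.
  by lia.
have GN i : (i < r)%N -> G i `<=` U b N by move=> ir; have [] := GP i ir.
have UaN' : \big[setU/set0]_(a <= i < N) F i = U a b `|` U b N by [].
case=> [_|i ir]; rewrite UaN'.
  split; [exact: cU|exact: subsetUl|exact: tb|].
  by case=> [|j] // jr _ k [Uk /(GN _ jr) Gk]; apply: (disj k).
have [cGi GiN tGi Gij] := GP i ir; split=> //.
  by move=> k /GiN Gk; right.
case=> [|j] jr ij k [Gi Gj]; first by apply: (disj k); split=> //; exact: GN Gi.
by apply: (Gij j _ _ k) => // ij'; apply: ij; rewrite ij'.
Qed.

Variables (n r : nat).
Hypotheses (n0 : (0 < n)%N) (r0 : (0 < r)%N).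

(** The levels at distance [n] on either side of [F] exceed [F] in size by a factor at most [c], so
    a weight that is large on [F] and small there makes the ends of the tower negligible. *)
Definition good (c : R) (F : set K) := [/\ 0 < rho F,
  rho (iter n phi @^-1` F) <= c * rho F &
  rho (iter n psi @^-1` F) <= c * rho F].

(** In the application [r] comes from the semi-Fredholm property: [r] such sets would carry [r] slow
    functions with disjoint supports. *)
Hypothesis no_many : forall F : nat -> set K,
  (forall i, (i < r)%N -> clopen (F i) /\ good (r%:R *+ 4) (F i)) ->
  ~ forall i j, (i < r)%N -> (j < r)%N -> i <> j ->
    tower_disjoint n.*2 (F i) (F j).

Definition good_point (k : K) := forall A, clopen A -> A k ->
  exists F, [/\ clopen F, F `<=` A & good (r%:R *+ 4) F].

(** Among infinitely many good points one can choose [r] whose orbit segments of length [2n] never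
    meet. Small neighbourhoods of them have disjoint towers and contain good sets, against
    [no_many]. *)
Lemma finite_good_points : finite_set good_point.
Proof.
apply: contrapT => Pinf.
suff /(_ r)[k kP] q : exists k : nat -> K, forall i, (i < q)%N -> good_point (k i) /\
    forall j, (j < q)%N -> i <> j -> forall s t, (s < n.*2)%N -> (t < n.*2)%N ->
      iter s phi (k i) <> iter t phi (k j).
  have [G [cG Gsep]] := tower_neighbourhoods n.*2 [seq k i | i <- iota 0 r].
  have /choice[F FP] i : exists F, (i < r)%N ->
      [/\ clopen F, F `<=` G (k i) & good (r%:R *+ 4) F].
    have [/kP[Pk _]|ir] := ltnP i r; last by exists set0.
    by have [cGi Gi] := cG (k i); have [F ?] := Pk _ cGi Gi; exists F.
  apply: (@no_many F) => [i /FP[]|i j ir jr ij] //.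
  have [_ FGi _] := FP i ir; have [_ FGj _] := FP j jr.
  apply: (tower_disjointS FGi FGj); apply: Gsep => //.
  - by apply/mapP; exists i; rewrite ?mem_iota.
  - by apply/mapP; exists j; rewrite ?mem_iota.
  - by have [_] := kP i ir; apply.
elim: q => [|q [k kP]].
  (* Even the empty choice needs a value for the function [k]; if [K] is empty there are no good
     points at all. *)
  have [[k0 _]|nK] := EM (exists k : K, True); first by exists (fun=> k0).
  suff : finite_set good_point by [].
  suff -> : good_point = set0 by [].
  by rewrite predeqE => k; split=> // _; apply: nK; exists k.
(* The finitely many points whose orbit segment meets that of a point already chosen. *)
pose B := [seq iter p.1 psi (iter p.2 phi (k i)) | i <- iota 0 q,
  p <- [seq (s, t) | s <- iota 0 n.*2, t <- iota 0 n.*2]].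
have [k' [Pk' k'B]] : exists k', good_point k' /\ ~ [set` B] k'.
  apply: contrapT => /forallNP PB; apply: Pinf.
  apply: (sub_finite_set _ (finite_seq B)) => l Pl.
  by have /not_andP[//|/contrapT] := PB l.
have sep i s t : (i < q)%N -> (s < n.*2)%N -> (t < n.*2)%N ->
    iter s phi k' <> iter t phi (k i).
  move=> iq sn tn E; apply: k'B; apply/allpairsP; exists (i, (s, t)).
  rewrite /= mem_iota iq -E (iter_cancel s phiK); split=> //.
  by apply/allpairsP; exists (s, t); rewrite /= !mem_iota.
exists (fun i => if i == q then k' else k i) => i.
rewrite ltnS leq_eqVlt => /predU1P[->|iq].
  rewrite eqxx; split=> // j.
  rewrite ltnS leq_eqVlt => /predU1P[->//|jq] _ s t sn tn.
  by rewrite (ltn_eqF jq); exact: sep.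
rewrite (ltn_eqF iq); split=> [|j]; first by have [] := kP i iq.
rewrite ltnS leq_eqVlt => /predU1P[->|jq] ij s t sn tn.
  by rewrite eqxx => /esym; exact: sep.
by rewrite (ltn_eqF jq); have [_] := kP i iq; apply.
Qed.

(** Otherwise compactness cuts [F] into pieces lighter than [tau = rho F / 2r], which regroup into
    [r] disjoint blocks of size at least [tau]. Each block has at least the fraction [1 / 2r] of the
    size of [F], so the constant [2] becomes [4r]; their towers are disjoint because [F] is
    wandering. This contradicts [no_many]. *)
Lemma good_point_exists (F : set K) : clopen F -> wandering n.*2 F ->
  good 2 F -> exists2 k, F k & good_point k.
Proof.
move=> cF wF [F0 F1 F2]; apply: contrapT => nP.
have rR : 0 < r%:R :> R by rewrite ltr0n.
pose tau : R := rho F / (r%:R *+ 2).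
have tau0 : 0 < tau by rewrite divr_gt0 // pmulrn_lgt0.
have rhoF : rho F = tau *+ 2 *+ r.
  by rewrite -mulr_natr -[tau *+ 2]mulr_natr /tau; field; rewrite lt0r_neq0.
have heavy H : clopen H -> H `<=` F -> tau <= rho H -> good (r%:R *+ 4) H.
  move=> cH HF tH.
  have FH : 2 * rho F <= r%:R *+ 4 * rho H.
    have -> : 2 * rho F = r%:R *+ 4 * tau by rewrite /tau; field; exact: lt0r_neq0.
    by rewrite ler_wpM2l // mulrn_wge0 // ltW.
  split; first exact: lt_le_trans tH.
  - apply: le_trans FH; apply: le_trans F1; apply: rho_mono => [||k /HF//];
      exact: clopen_iter.
  - apply: le_trans FH; apply: le_trans F2; apply: rho_mono => [||k /HF//];
      exact: clopen_iter.
have [|N [A [cA [AP Acov]]]] := @clopen_finite_cover _ compactK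
    (fun A => forall H, clopen H -> H `<=` F -> H `<=` A -> rho H < tau).
  move=> k; have [Fk|nFk] := EM (F k); last first.
    exists (~` F); split=> //; first exact: (@clopenC _ _ set0).
    move=> H cH HF HF'; suff -> : H = set0 by rewrite rho_set0.
    by rewrite -subset0 => l Hl; exact: HF' (HF _ Hl).
  have : ~ good_point k by move=> Pk; apply: nP; exists k.
  move=> /existsNP[A /not_implyP[cA /not_implyP[Ak /forallNP nA]]].
  exists A; split=> // H cH HF HA; rewrite ltNge; apply/negP => tH.
  by apply: (nA H); split=> //; exact: heavy.
pose H i := seqDU A i `&` F.
have cH i : clopen (H i).
  apply: clopenI => //; apply: clopenD => //.
  by rewrite -(big_mkord xpredT); exact: clopen_bigsetU.
have FH : F = \big[setU/set0]_(0 <= i < N) H i.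
  rewrite predeqE => k; split=> [Fk|/in_bigsetU[i _ []]//].
  have ex : exists i, `[< A i k >] by have [i _ Ai] := Acov k; exists i; apply/asboolP.
  case: (ex_minnP ex) => i /asboolP Ai mini; apply/in_bigsetU; exists i.
    have [j jN Aj] := Acov k; rewrite leq0n; apply: leq_ltn_trans jN.
    by apply: mini; apply/asboolP.
  split=> //; split=> //; rewrite -(big_mkord xpredT) => /in_bigsetU[j ji Aj].
  by have : (i <= j)%N; [apply: mini; apply/asboolP|lia].
have tH : trivIset setT H.
  move=> i j _ _ [k [[Hi _] [Hj _]]].
  by apply: (@trivIset_seqDU _ A i j) => //; exists k.
have lH i : (i < N)%N -> rho (H i) < tau.
  by move=> iN; apply: AP iN _ (cH i) _ _ => k [] // [].
have [|G GP] := @heavy_blocks H N tau tau0 cH tH lH r 0.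
  by rewrite -FH rhoF.
apply: (@no_many G) => [i ir|i j ir jr ij].
  have [cG GF tG _] := GP i ir; split=> //; apply: heavy => //.
  by rewrite FH.
have [_ GiF _ /(_ _ jr ij) Gij] := GP i ir; have [_ GjF _ _] := GP j jr.
by apply: (wandering_tower_disjoint wF) => //; rewrite FH.
Qed.

(** Growth cannot turn back: once [u j.+1] exceeds [2 * u j], the second alternative of the
    hypothesis is impossible at [j.+1]. *)
Lemma doubling (u : nat -> R) (L : nat) : 0 < u 0 -> 2 * u 0 < u 1 ->
  (forall j, (j < L)%N -> 0 < u j.+1 ->
     2 * u j.+1 < u j.+2 \/ 2 * u j.+1 < u j) ->
  2 ^+ L * u 0 <= u L.
Proof.
move=> u0 u1 step.
suff /(_ L (leqnn _))[] : forall j, (j <= L)%N ->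
  2 ^+ j * u 0 <= u j /\ 0 < u j /\ 2 * u j < u j.+1 by [].
elim=> [|j IHj] jL; first by rewrite expr0 mul1r.
have [uj [uj0 uj1]] := IHj (ltnW jL); split; first by rewrite exprS; lra.
have ujS : 0 < u j.+1 by lra.
by split=> //; have [//|?] := step j jL ujS; lra.
Qed.

Variable M : R.
Hypothesis rho_le : forall A, clopen A -> rho A <= M.

(** No preimage of [A] along a multiple [j * n], [j <= L], in either direction is good with constant
    [2], since it would contain a good point. So the size more than doubles on one side of [A],
    keeps doubling on that side, and remains below [M]. *)
Lemma wandering_small (L : nat) (A : set K) : clopen A -> wandering n.*2 A ->
  (forall j k, (j <= L)%N -> good_point k ->
    ~ A (iter (j * n) phi k) /\ ~ A (iter (j * n) psi k)) ->
  2 ^+ L * rho A <= M.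
Proof.
move=> cA wA avoid.
have [A0|A0] := ltP 0 (rho A); last first.
  have : rho set0 <= M by apply: rho_le; exact: clopen0.
  rewrite rho_set0; have : 2 ^+ L * rho A <= 0 by rewrite mulr_ge0_le0 // exprn_ge0.
  by lra.
pose f j := rho (iter (j * n) phi @^-1` A).
pose b j := rho (iter (j * n) psi @^-1` A).
have fS j : iter n phi @^-1` (iter (j * n) phi @^-1` A) = iter (j.+1 * n) phi @^-1` A.
  by rewrite predeqE => k /=; rewrite -iterD mulSn addnC.
have bS j : iter n psi @^-1` (iter (j * n) psi @^-1` A) = iter (j.+1 * n) psi @^-1` A.
  by rewrite predeqE => k /=; rewrite -iterD mulSn addnC.
have fP j : iter n psi @^-1` (iter (j.+1 * n) phi @^-1` A) = iter (j * n) phi @^-1` A.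
  by rewrite predeqE => k /=; rewrite mulSn addnC iterD (iter_cancel n psiK).
have bP j : iter n phi @^-1` (iter (j.+1 * n) psi @^-1` A) = iter (j * n) psi @^-1` A.
  by rewrite predeqE => k /=; rewrite mulSn addnC iterD (iter_cancel n phiK).
have nf j : (j <= L)%N -> ~ good 2 (iter (j * n) phi @^-1` A).
  move=> jL gA.
  have cB : clopen (iter (j * n) phi @^-1` A) by exact: clopen_iter.
  have wB : wandering n.*2 (iter (j * n) phi @^-1` A).
    by move=> s k sn /= As; rewrite iter_phi_add; exact: (wA s).
  have [k /= Ak Pk] := good_point_exists cB wB gA.
  by have [] := avoid j k jL Pk.
have nb j : (j <= L)%N -> ~ good 2 (iter (j * n) psi @^-1` A).
  move=> jL gA.
  have cB : clopen (iter (j * n) psi @^-1` A) by exact: clopen_iter.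
  have wB : wandering n.*2 (iter (j * n) psi @^-1` A).
    by move=> s k sn /= As; rewrite iter_psi_phi; exact: (wA s).
  have [k /= Ak Pk] := good_point_exists cB wB gA.
  by have [] := avoid j k jL Pk.
have Mf j : f j <= M by apply: rho_le; exact: clopen_iter.
have Mb j : b j <= M by apply: rho_le; exact: clopen_iter.
have notgood (x y z : R) : 0 < x -> ~ [/\ 0 < x, y <= 2 * x & z <= 2 * x] ->
    2 * x < y \/ 2 * x < z.
  move=> x0 /not_and3P[//|/negP|/negP]; rewrite -ltNge; [by left|by right].
have [u1|u1] : 2 * f 0 < f 1 \/ 2 * f 0 < b 1.
  apply: notgood => //; have := nf 0 (leq0n _).
  rewrite /good fS.
  by have -> : iter n psi @^-1` (iter (0 * n) phi @^-1` A) = iter (1 * n) psi @^-1` A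
    by exact: bS 0.
- apply: le_trans (Mf L); apply: (@doubling f) => // j jL fj.
  by apply: notgood => //; have := nf j.+1 jL; rewrite /good fS fP.
- apply: le_trans (Mb L); apply: (@doubling b) => // j jL bj.
  apply: notgood => //; have := nb j.+1 jL; rewrite /good bS bP => H [? ? ?].
  by apply: H.
Qed.

(** [Q L] collects the first [L] steps of length [n], in both directions, from the finitely many
    good points. Cutting [A] along a finite cover by wandering sets costs the factor [N]. *)
Lemma small_away_from_orbits : exists (C : R) (Q : nat -> seq K), 0 <= C /\
  forall L A, clopen A -> (forall k, k \in Q L -> ~ A k) -> 2 ^+ L * rho A <= C.
Proof.
have [N [W [cW [wW covW]]]] :=
  clopen_finite_cover compactK (wandering_neighbourhood n.*2).
have [q qE] := (finite_seqP _).1 finite_good_points.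
pose Q L := [seq iter (j * n) phi k | j <- iota 0 L.+1, k <- q] ++
  [seq iter (j * n) psi k | j <- iota 0 L.+1, k <- q].
have M0 : 0 <= M by rewrite -rho_set0; apply: rho_le; exact: clopen0.
exists (M *+ N), Q; split=> [|L A cA AQ]; first exact: mulrn_wge0.
have cAW i : clopen (A `&` W i) by exact: clopenI.
have -> : A = \big[setU/set0]_(0 <= i < N) (A `&` W i).
  rewrite predeqE => k; split=> [Ak|/in_bigsetU[i _ []]//].
  by apply/in_bigsetU; have [i iN Wi] := covW k; exists i.
apply: (@le_trans _ _ (\sum_(0 <= i < N) 2 ^+ L * rho (A `&` W i))).
  by rewrite -mulr_sumr ler_pM2l ?exprn_gt0 //; exact: rho_bigsetU.
have -> : M *+ N = \sum_(0 <= i < N) M by rewrite sumr_const_nat subn0.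
rewrite !big_nat; apply: ler_sum => i /andP[_ iN].
apply: wandering_small => // [s k sn [_ Wk] [_]|j k jL Pk].
  exact: (wW i iN).
have kq : k \in q by have : [set` q] k by rewrite -qE.
have jQ : j \in iota 0 L.+1 by rewrite mem_iota /= ltnS.
by split=> -[Aj _]; apply: AQ Aj; rewrite mem_cat; apply/orP; [left|right];
  apply/allpairsP; exists (j, k).
Qed.

End Towers.

Local Open Scope complex_scope.

(** * Operators with closed range *)

Section RealNorm.
Context {R : realType}.

Lemma normc_real (z : R[i]) : `|z| = (complex.Re `|z|)%:C.
Proof. by rewrite RRe_real. Qed.

Lemma gt0_complexP (e : R[i]) : 0 < e -> exists2 r : R, 0 < r & e = r%:C.
Proof.
move=> e0; exists (complex.Re e); last by rewrite RRe_real // gtr0_real.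
by rewrite -ltcR RRe_real // gtr0_real.
Qed.

Context {X : normedModType R[i]}.
Implicit Types (x y : X) (u : nat -> X).

Definition nrm x : R := complex.Re `|x|.

Lemma nrmE x : `|x| = (nrm x)%:C.
Proof. by rewrite RRe_real // normr_real. Qed.

Lemma nrm_ge0 x : 0 <= nrm x.
Proof. by rewrite -lecR -nrmE; exact: normr_ge0. Qed.

Lemma nrm0 : nrm (0 : X) = 0.
Proof. by apply: complexI; rewrite -nrmE normr0. Qed.

Lemma nrm0_eq0 x : nrm x = 0 -> x = 0.
Proof. by move=> x0; apply/eqP; rewrite -normr_eq0 nrmE x0. Qed.

Lemma nrm_gt0 x : x <> 0 -> 0 < nrm x.
Proof. by move=> x0; rewrite lt_def nrm_ge0 andbT; apply/eqP => /nrm0_eq0. Qed.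

Lemma nrmD x y : nrm (x + y) <= nrm x + nrm y.
Proof. by rewrite -lecR rmorphD /= -!nrmE ler_normD. Qed.

Lemma nrmN x : nrm (- x) = nrm x.
Proof. by rewrite /nrm normrN. Qed.

Lemma nrmBC x y : nrm (x - y) = nrm (y - x).
Proof. by rewrite -nrmN opprB. Qed.

Lemma nrmB x y : nrm (x - y) <= nrm x + nrm y.
Proof. by rewrite -(nrmN y); exact: nrmD. Qed.

Lemma nrmB_trans z x y : nrm (x - y) <= nrm (x - z) + nrm (z - y).
Proof. by rewrite -[x - y](subrKA z); exact: nrmD. Qed.

Lemma nrmZ (c : R[i]) x : nrm (c *: x) = complex.Re `|c| * nrm x.
Proof. by apply: complexI; rewrite -nrmE normrZ nrmE [in LHS]normc_real rmorphM. Qed.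

Lemma nrmZr (c : R) x : nrm (c%:C *: x) = `|c| * nrm x.
Proof. by rewrite nrmZ normc_def /= expr0n addr0 sqrtr_sqr. Qed.

Lemma nrm_sum (I : Type) (s : seq I) (P : pred I) (F : I -> X) :
  nrm (\sum_(i <- s | P i) F i) <= \sum_(i <- s | P i) nrm (F i).
Proof.
elim/big_ind2: _ => [|x a y b xa yb|//]; first by rewrite nrm0.
by apply: le_trans (nrmD _ _) _; exact: lerD.
Qed.

Lemma cvg_nrmP u l : u @ \oo --> l <->
  forall e, 0 < e -> exists N, forall n, (N <= n)%N -> nrm (u n - l) < e.
Proof.
split=> [/cvgrPdist_lt ul e e0|ul].
  have [|N _ NP] := ul e%:C; first by rewrite ltcR.
  exists N => n Nn; rewrite nrmBC -ltcR -nrmE; exact: NP.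
apply/cvgrPdist_lt => _ /gt0_complexP[e e0 ->].
have [N NP] := ul e e0; exists N => // n /= Nn.
by rewrite nrmE ltcR nrmBC; exact: NP.
Qed.

Lemma closed_nrmP (A : set X) :
  closed A <-> forall l, (forall e, 0 < e -> exists2 a, A a & nrm (a - l) < e) -> A l.
Proof.
split=> [cA l Al|Al l clA].
  apply: cA => B /nbhs_ballP[_ /gt0_complexP[e e0 ->]] eB.
  have [a Aa ale] := Al e e0; exists a; split=> //; apply: eB.
  by rewrite -ball_normE /ball_ /= nrmE ltcR nrmBC.
apply: Al => e e0.
have [|a [Aa]] := clA (ball l e%:C); first by apply: nbhsx_ballx; rewrite ltcR.
rewrite -ball_normE /ball_ /= nrmE ltcR nrmBC => ale.
by exists a.
Qed.

Lemma bounded_linear_nrm (A : LX X) :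
  exists2 M, 0 < M & forall x, nrm (A x) <= M * nrm x.
Proof.
have A0 : {for 0, continuous A} by exact: cts_fun.
have /linear_boundedP := continuous_linear_bounded (0 : X) A0.
move=> /pinfty_ex_gt0[_ /gt0_complexP[M M0 ->] AM].
exists M => // x.
by rewrite -lecR rmorphM /= -!nrmE; exact: AM.
Qed.

Lemma le_cvg_nrm u l (C : R) : u @ \oo --> l ->
  (forall N, exists2 n, (N <= n)%N & nrm (u n) <= C) -> nrm l <= C.
Proof.
move=> /cvg_nrmP ul uC; apply/ler_addgt0Pr => e e0.
have [N NP] := ul e e0; have [n Nn unC] := uC N.
have := NP n Nn; have := nrmB_trans (u n) l 0; rewrite !subr0 (nrmBC l).
by lra.
Qed.

Lemma exprV2_lt (e : R) : 0 < e -> exists N, forall n, (N <= n)%N -> 2^-1 ^+ n < e.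
Proof.
move=> e0.
have : geometric (1 : R) 2^-1 @ \oo --> (0 : R) by apply: cvg_geometric; rewrite ger0_norm; lra.
move=> /cvgrPdist_lt /(_ e e0)[N _ NP]; exists N => n Nn.
have := NP n Nn; rewrite /= sub0r normrN mul1r ger0_norm //.
Qed.

End RealNorm.

Section Complete.
Context {R : realType} {X : completeNormedModType R[i]}.

Lemma geometric_cvg (u : nat -> X) (C : R) :
  (forall n, nrm (u n.+1 - u n) <= C * 2^-1 ^+ n) -> exists l : X, u @ \oo --> l.
Proof.
move=> uC.
have C0 : 0 <= C by have := uC 0; rewrite expr0 mulr1; apply: le_trans; exact: nrm_ge0.
have tail n k : nrm (u (n + k)%N - u n) <= C * 2 * (2^-1 ^+ n - 2^-1 ^+ (n + k)).
  elim: k => [|k IHk]; first by rewrite addn0 !subrr nrm0 mulr0.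
  have := nrmB_trans (u (n + k)%N) (u (n + k.+1)%N) (u n).
  have := uC (n + k)%N; rewrite addnS exprS.
  set p := 2^-1 ^+ n; set q := 2^-1 ^+ (n + k); move: IHk; rewrite -/p -/q.
  by rewrite !mulrBr; nra.
have tail' n k : nrm (u (n + k)%N - u n) <= C * 2 * 2^-1 ^+ n.
  apply: le_trans (tail n k) _; rewrite ler_wpM2l ?mulr_ge0 //.
  by rewrite gerBl exprn_ge0 // invr_ge0.
suff : cvg (u @ \oo) by move=> ul; exists (lim (u @ \oo)).
apply: cauchy_cvg; apply: cauchy_exP => _ /gt0_complexP[e e0 ->].
have D0 : 0 < C * 2 + 1 by lra.
have [N NP] := exprV2_lt (divr_gt0 e0 D0).
exists (u N); exists N => // n /= Nn.
rewrite -ball_normE /ball_ /= nrmE ltcR nrmBC -(subnKC Nn).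
apply: le_lt_trans (tail' N _) _.
have := NP N (leqnn N); rewrite ltr_pdivlMr //.
have : 0 <= 2^-1 ^+ N :> R by rewrite exprn_ge0 // invr_ge0.
by set p := 2^-1 ^+ N => p0 pe; nra.
Qed.

End Complete.

Section ClosedRange.
Context {R : realType} {X : completeNormedModType R[i]}.
Variables (S : X -> X) (M : R).
Hypotheses (SB : {morph S : x y / x - y})
  (SZ : forall c, {morph S : x / c *: x})
  (SM : forall x, nrm (S x) <= M * nrm x).

Let S0 : S 0 = 0. Proof. by rewrite -[in LHS](subrr 0) SB subrr. Qed.

Let SD : {morph S : x y / x + y}.
Proof. by move=> x y; rewrite -[in LHS](opprK y) SB -[- y]sub0r SB S0 sub0r opprK. Qed.

Let M0 : 0 <= M \/ forall x : X, x = 0.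
Proof.
have [[x /eqP x0]|nx] := EM (exists x : X, x != 0).
  left; rewrite -(pmulr_lge0 _ (nrm_gt0 x0)).
  by apply: le_trans (SM x); exact: nrm_ge0.
by right=> x; apply: contrapT => /eqP ?; apply: nx; exists x.
Qed.

Lemma cvg_bounded (u : nat -> X) (l : X) : u @ \oo --> l -> S \o u @ \oo --> S l.
Proof.
case: M0 => [M0'|X0] /cvg_nrmP ul; apply/cvg_nrmP => e e0; last first.
  by exists 0 => n _; rewrite [_ - _]X0 nrm0.
have D0 : 0 < M + 1 by lra.
have [N NP] := ul _ (divr_gt0 e0 D0); exists N => n Nn.
have := NP n Nn; rewrite /= -SB ltr_pdivlMr // => lt.
by have := SM (u n - l); have := nrm_ge0 (u n - l); nra.
Qed.

(** [y] is in the closure of the image of the ball of radius [k]. *)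
Let adh (k : R) (y : X) :=
  forall e, 0 < e -> exists2 x, nrm x <= k & nrm (S x - y) <= e.

Lemma bounded_below_closed_range (c : R) : 0 < c ->
  (forall x, c * nrm x <= nrm (S x)) -> closed (range S : set X).
Proof.
move=> c0 cS; apply/closed_nrmP => l Sl.
have /choice[u uP] n : exists x, nrm (S x - l) < 2^-1 ^+ n.
  have [|_ [x _ <-] ?] := Sl (2^-1 ^+ n); last by exists x.
  by rewrite exprn_gt0 // invr_gt0.
have [|x ux] := @geometric_cvg R X u (2 / c).
  move=> n; rewrite mulrAC ler_pdivlMr // mulrC.
  apply: le_trans (cS _) _; rewrite SB.
  have := nrmB_trans l (S (u n.+1)) (S (u n)); rewrite (nrmBC l).
  have := uP n; have := uP n.+1; rewrite exprS.
  have : 0 <= 2^-1 ^+ n :> R by rewrite exprn_ge0 // invr_ge0.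
  by set p := 2^-1 ^+ n => A1 A2 A3;  lra.
exists x => //; apply/eqP; rewrite -subr_eq0; apply/eqP/nrm0_eq0/eqP.
rewrite eq_le nrm_ge0 andbT; apply/ler_addgt0Pr => e e0; rewrite add0r.
have /cvg_nrmP/(_ (e / 2))[|N1 N1P] := cvg_bounded ux; first by lra.
have [|N2 N2P] := @exprV2_lt R (e / 2); first by lra.
pose n := maxn N1 N2.
have := N1P n (leq_maxl _ _); have := N2P n (leq_maxr _ _); have := uP n.
have := nrmB_trans (S (u n)) (S x) l; rewrite (nrmBC (S x) (S (u n))) /=.
by lra.
Qed.

Hypothesis cS : closed (range S : set X).

(* Baire's argument in the complete subspace [range S], which is not itself a
   normed module. *)
Lemma adh_interior : exists k z r, 0 < r /\
  forall y, range S y -> nrm (y - S z) <= r -> adh k y.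
Proof.
apply: contrapT => nadh.
(* If no [adh k] contains a ball of the range, every ball contains a smaller one that misses the
   image of the ball of radius [k]. *)
have step (k : R) (z : X) r : 0 < r -> exists z' r', [/\ 0 < r', r' <= r / 2,
    nrm (S z' - S z) <= r / 2 & forall x, nrm x <= k -> r' < nrm (S x - S z')].
  move=> r0; have r20 : 0 < r / 2 by lra.
  apply: contrapT => nz; apply: nadh; exists k, z, (r / 2); split=> // _ [z' _ <-] z'z.
  move=> e e0; apply: contrapT => /forall2NP eP; apply: nz.
  exists z', (Num.min e (r / 2)).
  rewrite lt_min e0 ge_min lexx orbT r20; split=> // x xk.
  have [//|/negP] := eP x; rewrite -ltNge => ex.
  by apply: le_lt_trans ex; rewrite ge_min lexx.
have /choice[f fP] (p : nat * (X * R)) : exists q : X * R, 0 < p.2.2 ->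
    [/\ 0 < q.2, q.2 <= p.2.2 / 2, nrm (S q.1 - S p.2.1) <= p.2.2 / 2 &
      forall x, nrm x <= p.1%:R -> q.2 < nrm (S x - S q.1)].
  case: p => k [z r]; have [r0|] := EM (0 < r); last by exists (z, r).
  by have [z' [r' ?]] := step k%:R z r r0; exists (z', r').
(* Nested balls with centres [S (s n).1] and radii [(s n).2]; ball [n.+1] misses the image of the
   ball of radius [n]. *)
pose s := fix s n := if n is n'.+1 then f (n', s n') else ((0, 1) : X * R).
have s0 n : 0 < (s n).2.
  by elim: n => [|n IHn] //=; have [] := fP (n, s n) IHn.
have sP n := fP (n, s n) (s0 n).
have s2 n : (s n).2 <= 2^-1 ^+ n.
  elim: n => [|n IHn] //; have [_ + _ _] := sP n.
  by rewrite exprS /=; lra.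
have nest n k : nrm (S (s (n + k)%N).1 - S (s n).1) <= (s n).2 - (s (n + k)%N).2.
  elim: k => [|k IHk]; first by rewrite addn0 !subrr nrm0.
  rewrite addnS; have [_ + + _] := sP (n + k)%N.
  have := nrmB_trans (S (s (n + k)%N).1) (S (s (n + k).+1).1) (S (s n).1).
  by rewrite /=; lra.
have [|l sl] := @geometric_cvg R X (fun n => S (s n).1) 1.
  move=> n; rewrite mul1r; have := nest n 1; have := s2 n; have := s0 (n + 1)%N.
  by rewrite addn1; lra.
have ln n : nrm (l - S (s n).1) <= (s n).2.
  apply/ler_addgt0Pr => e e0; have /cvg_nrmP/(_ e e0)[N NP] := sl.
  have := NP (n + N)%N (leq_addl _ _); have := nest n N; have := s0 (n + N)%N.
  have := nrmB_trans (S (s (n + N)%N).1) l (S (s n).1).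
  by rewrite (nrmBC l (S (s (n + N)%N).1)); lra.
have [x _ xl] : range S l.
  apply: (closed_nrmP _).1 => // e e0; have /cvg_nrmP/(_ e e0)[N NP] := sl.
  by exists (S (s N).1); [exists (s N).1|exact: NP].
(* The limit [S x] belongs to all the balls, but ball [k.+1] misses it since [nrm x <= k]. *)
pose k := (Num.truncn (nrm x)).+1.
have xk : nrm x <= k%:R by apply: ltW; exact: truncnS_gt.
have [_ _ _ /(_ x xk)] := sP k; rewrite xl => lt.
by have := ln k.+1; rewrite leNgt lt.
Qed.

(** Scale [S z] by [t] to norm [r], approximate [S (z0 + t z)] and [S z0] by images of vectors of
    norm at most [k], subtract and divide by [t]. Each approximation may err by [e * t / 2]. *)
Lemma approx_preimage : exists2 C, 0 <= C & forall z e, 0 < e ->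
  exists2 x, nrm x <= C * nrm (S z) & nrm (S x - S z) <= e.
Proof.
have [k [z0 [r [r0 adhk]]]] := adh_interior.
have rng z : range S (S z) by exists z.
have k0 : 0 <= k.
  have [|x xk _] := adhk _ (rng z0) _ 1 ltr01.
    by rewrite subrr nrm0 ltW.
  by apply: le_trans xk; exact: nrm_ge0.
exists (2 * k / r) => [|z e e0]; first by rewrite !mulr_ge0 // invr_ge0 ltW.
have [Sz0|Sz] := EM (S z = 0).
  by exists 0; rewrite ?S0 Sz0 ?subrr nrm0 ?mulr0 //; exact: ltW.
have Sz' := nrm_gt0 Sz; pose t := r / nrm (S z).
have t0 : 0 < t by exact: divr_gt0.
have te : 0 < e * t / 2 by apply: divr_gt0 => //; exact: mulr_gt0.
have [|x1 x1k x1e] := adhk _ (rng (z0 + t%:C *: z)) _ _ te.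
  by rewrite SD addrC addKr SZ nrmZr gtr0_norm // /t divfK // gt_eqF.
have [|x2 x2k x2e] := adhk _ (rng z0) _ _ te.
  by rewrite subrr nrm0 ltW.
have tv : 0 < t^-1 by rewrite invr_gt0.
exists (t^-1%:C *: (x1 - x2)).
  have -> : 2 * k / r * nrm (S z) = t^-1 * (2 * k).
    by rewrite /t invf_div; ring.
  rewrite nrmZr gtr0_norm // ler_wpM2l //; first exact: ltW.
  by apply: le_trans (nrmB _ _) _; lra.
have -> : S (t^-1%:C *: (x1 - x2)) - S z =
    t^-1%:C *: ((S x1 - S (z0 + t%:C *: z)) - (S x2 - S z0)).
  rewrite SZ SB SD SZ.
  have -> : S x1 - (S z0 + t%:C *: S z) - (S x2 - S z0) = S x1 - S x2 - t%:C *: S z.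
    by rewrite [- (S x2 - _)]opprD opprK addrACA opprD (addrAC (- S z0)) addNr add0r.
  by rewrite [in RHS]scalerBr scalerA -rmorphM mulVf ?gt_eqF // scale1r.
rewrite nrmZr gtr0_norm // mulrC ler_pdivrMr //.
by apply: le_trans (nrmB _ _) _; lra.
Qed.

(** Subtracting an approximate preimage halves the remaining image. The corrections form a geometric
    series, whose sum doubles the constant. *)
Lemma bounded_preimage : exists2 C, 0 <= C & forall z,
  exists2 x, S x = S z & nrm x <= C * nrm (S z).
Proof.
have [C C0 approx] := approx_preimage.
have /choice[f fP] z : exists x, nrm x <= C * nrm (S z) /\
    nrm (S z - S x) <= nrm (S z) / 2.
  have [Sz|/nrm_gt0 Sz] := EM (S z = 0).
    by exists 0; rewrite S0 Sz subr0 nrm0 mulr0 mul0r.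
  by have [|x xC xz] := approx z (nrm (S z) / 2); [lra|exists x; rewrite nrmBC].
exists (C * 2) => [|z]; first by rewrite mulr_ge0.
pose s n := iter n (fun y => y - f y) z.
have sn n : nrm (S (s n)) <= nrm (S z) * 2^-1 ^+ n.
  elim: n => [|n IHn]; first by rewrite mulr1.
  by have [_] := fP (s n); rewrite /= SB exprS; lra.
pose u n := z - s n.
have uS n : u n.+1 = u n + f (s n) by rewrite /u /= opprB addrA addrAC.
have [|x ux] := @geometric_cvg R X u (C * nrm (S z)).
  move=> n; rewrite uS addrAC subrr add0r.
  by have [+ _] := fP (s n); have := ler_wpM2l C0 (sn n); lra.
exists x.
  have Su n : S (u n) = S z - S (s n) by rewrite SB.
  apply/eqP; rewrite -subr_eq0; apply/eqP/nrm0_eq0/eqP.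
  rewrite eq_le nrm_ge0 andbT; apply/ler_addgt0Pr => e e0; rewrite add0r.
  have /cvg_nrmP/(_ (e / 2))[|N1 N1P] := cvg_bounded ux; first by lra.
  have D0 : 0 < (nrm (S z) + 1) * 2 by have := nrm_ge0 (S z); lra.
  have [N2 N2P] := exprV2_lt (divr_gt0 e0 D0).
  pose n := maxn N1 N2.
  have := N1P n (leq_maxl _ _); have := N2P n (leq_maxr _ _); have := sn n.
  have := nrmB_trans (S (u n)) (S x) (S z); rewrite (nrmBC (S x) (S (u n))) /=.
  rewrite [S (u n) - S z]addrC Su addKr nrmN ltr_pdivlMr //.
  have : 0 <= 2^-1 ^+ n :> R by rewrite exprn_ge0 // invr_ge0.
  by have := nrm_ge0 (S z); set p := 2^-1 ^+ n; nra.
have u0 : u 0 = 0 by rewrite /u subrr.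
have tail n : nrm (u n) <= C * nrm (S z) * (2 - 2 * 2^-1 ^+ n).
  elim: n => [|n IHn]; first by rewrite u0 nrm0 expr0 mulr1 subrr mulr0.
  have := nrmD (u n) (f (s n)); have [+ _] := fP (s n).
  have := ler_wpM2l C0 (sn n).
  by move: IHn; rewrite uS exprS; set p := 2^-1 ^+ n; lra.
apply: (le_cvg_nrm ux) => N; exists N => //; apply: le_trans (tail N) _.
have : 0 <= 2^-1 ^+ N :> R by rewrite exprn_ge0 // invr_ge0.
by move=> /(mulr_ge0 (mulr_ge0 C0 (nrm_ge0 (S z)))); lra.
Qed.

End ClosedRange.

(** * Semi-Fredholm operators and almost-kernel vectors *)

Section Fredholm.
Context {R : realType} {X : completeNormedModType R[i]}.

Lemma linear_dependence (n : nat) (e : 'I_n -> X) (z : 'I_n.+1 -> X) :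
  (forall i, exists c : 'I_n -> R[i], z i = \sum_j c j *: e j) ->
  exists c : 'I_n.+1 -> R[i], (exists i, c i != 0) /\ \sum_i c i *: z i = 0.
Proof.
move=> /choice[a za]; pose A : 'M[R[i]]_(n.+1, n) := \matrix_(i, j) a i j.
have : kermx A != 0.
  rewrite -mxrank_eq0 mxrank_ker subn_eq0 -ltnNge ltnS; exact: rank_leq_col.
move=> /rowV0Pn[v /sub_kermxP vA v0]; exists (v 0); split.
  by have [i vi] := rV0Pn _ v0; exists i.
under eq_bigr do rewrite za scaler_sumr.
rewrite exchange_big big1 // => j _.
under eq_bigr do rewrite scalerA.
rewrite -scaler_suml; have /matrixP/(_ 0 j) := vA; rewrite !mxE => vAj.
by rewrite (eq_bigr (fun i => v 0 i * A i j)) ?vAj ?scale0r // => i _; rewrite mxE.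
Qed.

Variables (S : X -> X) (M : R).
Hypotheses (SB : {morph S : x y / x - y})
  (SZ : forall c, {morph S : x / c *: x})
  (SM : forall x, nrm (S x) <= M * nrm x).

(* The family is within [C * eps] of the kernel, so a linear relation in the
   kernel contradicts the almost-orthogonality. *)
Lemma almost_kernel_bound : upper_semi_fredholm S ->
  exists (d : nat) (eps : R), [/\ (0 < d)%N, 0 < eps &
    forall u : 'I_d -> X, (forall i, 0 < nrm (u i)) ->
      (forall i, nrm (S (u i)) <= eps * nrm (u i)) ->
      ~ forall i (c : 'I_d -> R[i]), nrm (c i *: u i) <= nrm (\sum_j c j *: u j)].
Proof.
move=> [cS [n [e kerE]]].
have [C C0 pre] := bounded_preimage SB SZ SM cS.
have D0 : 0 < (C + 1) * n.+1%:R * 2 by rewrite !mulr_gt0 ?ltr0n //; lra.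
(* With this [eps], [C * eps * n.+1 <= 1/2]: the [n.+1] corrections [c j *: v j] add up to at most
   half of the largest [c i *: u i]. *)
exists n.+1, ((C + 1) * n.+1%:R * 2)^-1; split=> //; first by rewrite invr_gt0.
set eps := _^-1 => u u0 Su disj.
have /choice[v vP] i : exists v, S v = S (u i) /\ nrm v <= C * nrm (S (u i)).
  by have [v ? ?] := pre (u i); exists v.
(* The [n.+1] vectors [u i - v i] lie in a kernel spanned by [n] vectors; a nontrivial relation
   between them equates the combinations of the [u j] and of the [v j]. *)
have [|c [[i1 ci1] cz]] := @linear_dependence n e (fun i => u i - v i).
  move=> i; have : [set x | S x = 0] (u i - v i).
    by rewrite /= SB; have [-> _] := vP i; rewrite subrr.
  by rewrite kerE => -[c _ <-]; exists c.
pose N i := nrm (c i *: u i).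
have [i0 _ maxN] := @arg_maxP _ _ _ i1 xpredT N isT.
have ci (i : 'I_n.+1) : 0 <= complex.Re `|c i| by rewrite -lecR -normc_real; exact: normr_ge0.
have vN i : nrm (c i *: v i) <= C * eps * N i.
  rewrite /N !nrmZ mulrCA; apply: ler_wpM2l => //.
  have [_ +] := vP i; have := ler_wpM2l C0 (Su i); lra.
have eqS : \sum_j c j *: u j = \sum_j c j *: v j.
  apply: subr0_eq; rewrite -sumrB -[RHS]cz; apply: eq_bigr => i _.
  by rewrite scalerBr.
have : N i0 <= C * eps * n.+1%:R * N i0.
  apply: le_trans (disj i0 c) _; rewrite eqS.
  apply: le_trans (nrm_sum _ _ _) _.
  apply: (@le_trans _ _ (\sum_(j < n.+1) C * eps * N i0)).
    apply: ler_sum => i _; apply: le_trans (vN i) _.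
    by apply: ler_wpM2l; [rewrite mulr_ge0 // invr_ge0 ltW|exact: maxN].
  rewrite sumr_const card_ord -[_ *+ _]mulr_natr; lra.
have Ni1 : 0 < N i1.
  rewrite /N nrmZ mulr_gt0 // lt_def ci andbT; apply: contra ci1 => /eqP ci0.
  by rewrite -normr_eq0 normc_real ci0.
have N0 : 0 < N i0 := lt_le_trans Ni1 (maxN i1 isT).
rewrite -[leLHS]mul1r ler_pM2r // leNgt => /negP; apply.
suff : C * eps * n.+1%:R <= 2^-1 by lra.
rewrite /eps !invfM.
have -> : C * ((C + 1)^-1 * n.+1%:R^-1 * 2^-1) * n.+1%:R = C / (C + 1) * 2^-1.
    have : (0 < n.+1%:R :> R) by rewrite ltr0n.
    by move: (n.+1%:R : R) => q q0; field; rewrite !gt_eqF //; lra.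
by rewrite ler_piMl // ler_pdivrMr; lra.
Qed.

(** [S] is bounded below, as violations of the bounds [2^-n] would normalise to approximate
    eigenvectors. Then the range is closed and the kernel zero. *)
Lemma not_ap_fredholm (A : X -> X) (l : R[i]) : S = shift_op l A ->
  ~ sigma_ap A l -> upper_semi_fredholm S.
Proof.
move=> SA nap.
have [c c0 cS] : exists2 c : R, 0 < c & forall x, c * nrm x <= nrm (S x).
  apply: contrapT => /forall2NP nc; apply: nap.
  have /choice[x xP] n : exists x : X, `|x| = 1 /\ nrm (S x) < 2^-1 ^+ n.
    have [/negP|] := nc (2^-1 ^+ n); first by rewrite exprn_gt0 // invr_gt0.
    move=> /existsNP[y /negP]; rewrite -ltNge => Sy.
    have y0 : 0 < nrm y.
      rewrite lt_def nrm_ge0 andbT; apply/eqP => y0; move: Sy.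
      by rewrite y0 mulr0 ltNge nrm_ge0.
    exists ((nrm y)^-1%:C *: y).
    rewrite nrmE SZ !nrmZr gtr0_norm ?invr_gt0 // mulVf ?gt_eqF //; split=> //.
    by rewrite mulrC ltr_pdivrMr.
  exists x; split=> [n|]; first by have [] := xP n.
  apply/cvg_nrmP => e e0; have [N NP] := exprV2_lt e0; exists N => n Nn.
  rewrite subr0 -nrmN opprB; have [_] := xP n; rewrite SA => /lt_trans; apply.
  exact: NP.
split; first exact: (bounded_below_closed_range SB SM c0 cS).
exists 0%N, (fun=> 0); rewrite predeqE => x; split=> [/= Sx|[f _ <-]].
  exists (fun=> 0) => //; rewrite big_ord0; apply/esym/nrm0_eq0/eqP.
  rewrite eq_le nrm_ge0 andbT -(ler_pM2l c0) mulr0.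
  by have := cS x; rewrite Sx nrm0.
by rewrite big_ord0 /=; have := SZ 0 0; rewrite !scale0r.
Qed.

(** If [S] were injective, the bounded preimages of [bounded_preimage] would be the vectors
    themselves, and [S] would be bounded below. *)
Lemma fredholm_ap_kernel (A : X -> X) (l : R[i]) : S = shift_op l A ->
  upper_semi_fredholm S -> sigma_ap A l -> exists2 x, x <> 0 & S x = 0.
Proof.
move=> SA [cS _] [x [x1 xl]]; apply: contrapT => /forall2NP nker.
have [C C0 pre] := bounded_preimage SB SZ SM cS.
have D0 : 0 < C + 1 by lra.
have /cvg_nrmP/(_ (C + 1)^-1)[|N /(_ N (leqnn N))] := xl; first by rewrite invr_gt0.
rewrite subr0 -nrmN opprB => lt.
have [y Sy yC] := pre (x N).
have yx : y - x N = 0.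
  have [/contrapT//|] := nker (y - x N).
  by rewrite SB Sy subrr.
move: yC; rewrite (subr0_eq yx).
have -> : nrm (x N) = 1 by apply: complexI; rewrite -nrmE x1.
rewrite leNgt => /negP; apply; rewrite SA.
rewrite -(ltr_pM2l D0) mulfV ?gt_eqF // in lt.
by have := nrm_ge0 (shift_op l A (x N)); rewrite /shift_op; lra.
Qed.

End Fredholm.

(** * Locally constant functions acting on the module *)

Section LocallyConstant.
Context {R : realType} {K : topologicalType}.

Definition locally_constant {T : Type} (f : K -> T) :=
  forall k, \forall l \near k, f l = f k.

(** [h] is arbitrary, for instance division or a test for zero; this freedom is the reason for
    working with locally constant functions. *)
Lemma locally_constant_comp2 (S T V : Type) (h : S -> T -> V) (f : K -> S) (g : K -> T) :
  locally_constant f -> locally_constant g -> locally_constant (fun k => h (f k) (g k)).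
Proof.
move=> lf lg k; have Hf := lf k; have Hg := lg k; near=> l.
by congr h; [near: l; exact: Hf|near: l; exact: Hg].
Unshelve. all: by end_near. Qed.

Lemma locally_constant_cst (T : Type) (c : T) : locally_constant (fun=> c).
Proof. by move=> k; exact: nearW. Qed.

Lemma locally_constant_continuous (T : topologicalType) (f : K -> T) :
  locally_constant f -> continuous f.
Proof.
move=> lf k A /nbhs_singleton Afk; have := lf k.
by apply: filterS => l /= ->.
Qed.

Lemma locally_constant_indic (A : set K) :
  clopen A -> locally_constant (\1_A : K -> R).
Proof.
move=> [oA cA] k; have [Ak|nAk] := EM (A k).
  have : nbhs k A by apply: open_nbhs_nbhs.
  by apply: filterS => l Al; rewrite !indicE !mem_set.
have : nbhs k (~` A) by apply: open_nbhs_nbhs; split=> //; exact: closed_openC.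
by apply: filterS => l nAl; rewrite !indicE !memNset.
Qed.

Lemma locally_constant_precomp (T : Type) (f : K -> T) (phi : K -> K) :
  continuous phi -> locally_constant f -> locally_constant (f \o phi).
Proof. by move=> cphi lf k; exact: (cphi k _ (lf (phi k))). Qed.

Lemma locally_constant_sum (I : Type) (s : seq I) (F : I -> K -> R) :
  (forall i, locally_constant (F i)) ->
  locally_constant (fun k => \sum_(i <- s) F i k).
Proof.
move=> lF; elim: s => [|i s IHs].
  by under [X in locally_constant X]eq_fun do rewrite big_nil; exact: locally_constant_cst.
under [X in locally_constant X]eq_fun do rewrite big_cons.
exact: (locally_constant_comp2 (fun a b => a + b)).
Qed.

End LocallyConstant.

Section Action.
Context {R : realType} {K : topologicalType} {X : normedModType R[i]}.
Variable m : CK R K -> LX X.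

(** Stating the condition inside the existential makes [to_CK] total; its value is unspecified where
    [f] is not locally constant. *)
Lemma to_CK_subproof (f : K -> R) :
  exists g : CK R K, locally_constant f -> forall k, g k = (f k)%:C.
Proof.
have [lf|nlf] := EM (locally_constant f); last by exists (cst 0 : CK R K).
have cf : continuous (fun k => (f k)%:C : (R[i])^o).
  apply: locally_constant_continuous => k.
  by have := lf k; apply: filterS => l ->.
by exists (mkcts cf).
Qed.

Definition to_CK (f : K -> R) : CK R K := sval (cid (to_CK_subproof f)).

Definition act (f : K -> R) (x : X) : X := m (to_CK f) x.

Lemma to_CKE (f : K -> R) : locally_constant f -> forall k, to_CK f k = (f k)%:C.
Proof. exact: (svalP (cid (to_CK_subproof f))). Qed.

Lemma opnorm_ge (A : LX X) (x : X) : nrm (A x) <= opnorm A * nrm x.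
Proof.
have [M M0 AM] := bounded_linear_nrm A.
have [x0|/nrm_gt0 x0] := EM (x = 0); first by rewrite x0 linear0 nrm0 mulr0.
rewrite -ler_pdivrMr //.
have -> : nrm (A x) / nrm x = nrm (A ((nrm x)^-1%:C *: x)).
  by rewrite linearZ nrmZr gtr0_norm ?invr_gt0 // mulrC.
apply: ub_le_sup.
  exists M => _ [y /= y1 <-]; apply: le_trans (AM y) _.
  by rewrite -[leRHS]mulr1 ler_pM2l // -lecR -nrmE.
exists ((nrm x)^-1%:C *: x) => //=.
by rewrite nrmE lecR nrmZr gtr0_norm ?invr_gt0 // mulVf // gt_eqF.
Qed.

Hypothesis bm : banach_module m.

Lemma module_ext (f g : CK R K) (x : X) : f =1 g -> m f x = m g x.
Proof. by move=> /continuousEP ->. Qed.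

Lemma actD (f g : K -> R) x : locally_constant f -> locally_constant g ->
  act (fun k => f k + g k) x = act f x + act g x.
Proof.
move=> lf lg; rewrite /act -(module_add bm); apply: module_ext => k /=.
rewrite (to_CKE lf) (to_CKE lg) to_CKE; first exact: rmorphD.
exact: (locally_constant_comp2 (fun a b => a + b)).
Qed.

Lemma actZ (a : R) (f : K -> R) x : locally_constant f ->
  act (fun k => a * f k) x = a%:C *: act f x.
Proof.
move=> lf; rewrite /act -(module_scale bm); apply: module_ext => k /=.
rewrite (to_CKE lf) to_CKE; first exact: rmorphM.
by apply: (locally_constant_comp2 (fun a b => a * b)) lf; exact: locally_constant_cst.
Qed.

Lemma actM (f g : K -> R) x : locally_constant f -> locally_constant g ->
  act (fun k => f k * g k) x = act f (act g x).
Proof.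
move=> lf lg; rewrite /act -(module_mul bm); apply: module_ext => k /=.
rewrite (to_CKE lf) (to_CKE lg) to_CKE; first exact: rmorphM.
exact: (locally_constant_comp2 (fun a b => a * b)).
Qed.

Lemma act1 x : act (fun=> 1) x = x.
Proof.
rewrite -[RHS](module_one bm) /act; apply: module_ext => k /=.
by rewrite to_CKE //; exact: locally_constant_cst.
Qed.

Lemma act0 x : act (fun=> 0) x = 0.
Proof.
have := @actZ 0 (fun=> 0) x (locally_constant_cst 0); rewrite scale0r => <-.
by congr act; apply/funext => k; rewrite mulr0.
Qed.

Lemma act_le (c : R) (f : K -> R) x : locally_constant f -> 0 <= c ->
  (forall k, `|f k| <= c) -> nrm (act f x) <= c * nrm x.
Proof.
move=> lf c0 fc; apply: le_trans (opnorm_ge _ _) _.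
apply: ler_wpM2r; first exact: nrm_ge0.
rewrite (module_isometric bm) /supnorm.
(* For empty [K] the supremum norm is the supremum of the empty set, which is [0]. *)
set D := [set _ | _ in _]; have [->|/set0P D0] := eqVneq D set0.
  by rewrite sup0.
apply: sup_le_ub => // _ [k _ <-].
by rewrite to_CKE // normc_def /= expr0n addr0 sqrtr_sqr.
Qed.

(* The quotient [g / f] is continuous, with value [0] where [f] vanishes, as
   [f] and [g] are locally constant. *)
Lemma act_mono (f g : K -> R) x : locally_constant f -> locally_constant g ->
  (forall k, `|g k| <= `|f k|) -> nrm (act g x) <= nrm (act f x).
Proof.
move=> lf lg gf; pose h k := g k / f k.
have lh : locally_constant h by exact: (locally_constant_comp2 (fun a b => a / b)).
have gE k : g k = h k * f k.
  have [f0|f0] := eqVneq (f k) 0; last by rewrite /h divfK.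
  by have := gf k; rewrite f0 normr0 normr_le0 mulr0 => /eqP.
have -> : g = (fun k => h k * f k) by apply/funext.
rewrite actM // -[leRHS]mul1r; apply: act_le => // k.
rewrite /h normrM normfV; have [f0|f0] := eqVneq (f k) 0.
  by rewrite f0 normr0 invr0 mulr0.
by rewrite ler_pdivrMr ?normr_gt0 // mul1r.
Qed.

End Action.

(** * Slowly varying weights on towers over an eigenvector *)

Section SlowFunctions.
Context {R : realType}.

(** Abel summation moves the shift from [v] to the slowly varying [c] and leaves one term at each
    end. *)
Lemma summation_by_parts_le (c v : nat -> R) (N : nat) (eta : R) :
  0 <= eta -> (forall i, 0 <= c i) -> (forall i, 0 <= v i) ->
  (forall i, (i < N)%N -> `|c i - c i.+1| <= eta * c i.+1) ->
  `|\sum_(0 <= i < N.+1) c i * v i.+1 - \sum_(0 <= i < N.+1) c i * v i| <=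
    eta * (\sum_(0 <= i < N.+1) c i * v i) + c 0 * v 0 + c N * v N.+1.
Proof.
move=> eta0 c0 v0 cv.
have -> : \sum_(0 <= i < N.+1) c i * v i.+1 - \sum_(0 <= i < N.+1) c i * v i =
    \sum_(0 <= i < N) (c i - c i.+1) * v i.+1 + c N * v N.+1 - c 0 * v 0.
  rewrite big_nat_recr //= [in X in _ - X]big_nat_recl //.
  under [in RHS]eq_bigr do rewrite mulrBl.
  by rewrite sumrB; ring.
have -> : \sum_(0 <= i < N.+1) c i * v i =
    c 0 * v 0 + \sum_(0 <= i < N) c i.+1 * v i.+1 by rewrite big_nat_recl.
have : `|\sum_(0 <= i < N) (c i - c i.+1) * v i.+1| <=
    eta * \sum_(0 <= i < N) c i.+1 * v i.+1.
  rewrite mulr_sumr; apply: le_trans (ler_norm_sum _ _ _) _.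
  rewrite !big_nat; apply: ler_sum => i /andP[_ iN].
  by rewrite normrM [`|v _|]ger0_norm // mulrA ler_wpM2r // cv.
have : 0 <= eta * (c 0 * v 0) by rewrite !mulr_ge0.
have : 0 <= c 0 * v 0 by rewrite mulr_ge0.
have : 0 <= c N * v N.+1 by rewrite mulr_ge0.
set A := \sum_(0 <= i < N) _ * _; set B := \sum_(0 <= i < N) c _.+1 * _.
rewrite ler_norml => ? ? ? /andP[? ?]; rewrite ler_norml; apply/andP; split; lra.
Qed.

Lemma bernoulli (a : R) (n : nat) : 0 <= a -> 1 + n%:R * a <= (1 + a) ^+ n.
Proof.
move=> a0; elim: n => [|n IHn]; first by rewrite mul0r addr0.
rewrite exprS; apply: le_trans (ler_wpM2l _ IHn); last by rewrite addr_ge0.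
have na : 0 <= n%:R * a * a by rewrite !mulr_ge0.
rewrite (_ : n.+1%:R = 1 + n%:R); last by rewrite -natr1 addrC.
by move: na; set q := n%:R; lra.
Qed.

(** The exponent rises by one up to the index [n] and then falls by one. Relative to the next weight
    the change is [eta / (1 + eta)] on the way up and [eta] on the way down. *)
Lemma tower_weight_step (eta : R) (n i : nat) : 0 <= eta -> (i < n.*2.-1)%N ->
  `|(1 + eta) ^+ minn i (n.*2 - i) - (1 + eta) ^+ minn i.+1 (n.*2 - i.+1)| <=
    eta * (1 + eta) ^+ minn i.+1 (n.*2 - i.+1).
Proof.
move=> eta0 iN; have Q0 : 0 <= 1 + eta by rewrite addr_ge0.
have [lo|hi] := ltnP i n.
  have -> : minn i (n.*2 - i) = i by lia.
  have -> : minn i.+1 (n.*2 - i.+1) = i.+1 by lia.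
  have : 0 <= (1 + eta) ^+ i by rewrite exprn_ge0.
  rewrite exprS; set q := _ ^+ i => q0.
  have -> : q - (1 + eta) * q = - (eta * q) by ring.
  rewrite normrN ger0_norm ?mulr_ge0 //.
  by rewrite ler_wpM2l // ler_peMl // lerDl.
have -> : minn i (n.*2 - i) = (n.*2 - i.+1).+1 by lia.
have -> : minn i.+1 (n.*2 - i.+1) = (n.*2 - i.+1)%N by lia.
have : 0 <= (1 + eta) ^+ (n.*2 - i.+1) by rewrite exprn_ge0.
rewrite exprS; set q := _ ^+ (n.*2 - i.+1) => q0.
have -> : (1 + eta) * q - q = eta * q by ring.
by rewrite ger0_norm ?mulr_ge0.
Qed.

End SlowFunctions.

Section Eigenvector.
Context {R : realType} {K : topologicalType} {X : completeNormedModType R[i]}.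
Variables (m : CK R K -> LX X) (phi psi : K -> K).
Hypotheses (bm : banach_module m) (cphi : continuous phi) (cpsi : continuous psi)
  (phiK : cancel phi psi) (psiK : cancel psi phi).
Variables (T : X -> X) (l : R[i]) (x : X).
Hypothesis T_act : forall f y, locally_constant f ->
  T (act m f y) = act m (f \o phi) (T y).
Hypothesis Tx : T x = l *: x.

Definition size_at (A : set K) : R := nrm (act m (\1_A) x).

Local Notation lc := locally_constant.

Lemma size_at_set0 : size_at set0 = 0.
Proof. by rewrite /size_at indic0 act0 // nrm0. Qed.

Lemma size_at_mono A B : clopen A -> clopen B -> A `<=` B -> size_at A <= size_at B.
Proof.
move=> cA cB AB; apply: act_mono => //; try exact: locally_constant_indic.
move=> k; rewrite !indicE !ger0_norm ?ler0n // ler_nat.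
by have [/set_mem Ak|//] := boolP (k \in A); rewrite mem_set //; exact: AB.
Qed.

Lemma size_atU A B : clopen A -> clopen B ->
  size_at (A `|` B) <= size_at A + size_at B.
Proof.
move=> cA cB; apply: le_trans (nrmD _ _).
rewrite -actD //; try exact: locally_constant_indic.
apply: act_mono => //; first by apply: (locally_constant_comp2 (fun a b => a + b));
  exact: locally_constant_indic.
  by apply: locally_constant_indic; exact: clopenU.
move=> k; rewrite !indicE !ger0_norm ?addr_ge0 ?ler0n // in_setU -natrD ler_nat.
by case: (k \in A); case: (k \in B).
Qed.

Lemma size_at_le A : clopen A -> size_at A <= nrm x.
Proof.
move=> cA; rewrite -[leRHS]mul1r; apply: act_le => //.
  exact: locally_constant_indic.
by move=> k; rewrite indicE ger0_norm ?ler0n // lern1 leq_b1.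
Qed.

Lemma shift_op_act f : lc f -> nrm (shift_op l T (act m f x)) =
  complex.Re `|l| * nrm (act m (fun k => f (phi k) - f k) x).
Proof.
move=> lf; rewrite -nrmZ -nrmN; congr nrm.
have lN : lc (fun k => -1 * f k).
  by apply: (locally_constant_comp2 (fun a b => a * b)) lf; exact: locally_constant_cst.
rewrite /shift_op T_act // Tx opprB.
have -> : act m (f \o phi) (l *: x) = l *: act m (f \o phi) x by rewrite /act linearZ.
have -> : (fun k => f (phi k) - f k) = (fun k => (f \o phi) k + (-1 * f k)).
  by apply/funext => k /=; rewrite mulN1r.
rewrite actD //; last exact: locally_constant_precomp.
by rewrite actZ // rmorphN rmorph1 scaleN1r scalerBr.
Qed.

(* The weights [Q ^ min (i, 2n - i)] along the tower vary by a factor at most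
   [Q]; the error created at the two ends of the tower is negligible against the
   weight [Q ^ n] at the centre. *)
Lemma slow_tower (kappa eps : R) : 0 <= kappa -> 0 < eps -> exists n, (0 < n)%N /\
  forall F, clopen F -> good phi psi size_at n kappa F ->
  exists g, [/\ lc g, 0 < nrm (act m g x),
    nrm (act m (fun k => g (phi k) - g k) x) <= eps * nrm (act m g x) &
    forall k, g k != 0 ->
      exists2 i, (i < n.*2)%N & F (iter i phi (iter n psi k))].
Proof.
move=> kappa0 eps0.
have [eta [eta0 eta1 eta2]] : exists eta, [/\ 0 < eta, eta <= 1 & eta <= eps / 2].
  exists (Num.min 1 (eps / 2)); split; last 2 first.
  - by rewrite ge_min lexx.
  - by rewrite ge_min lexx orbT.
  - by rewrite lt_min; apply/andP; split; lra.
(* The two ends contribute at most [kappa] and [Q * kappa <= 2 * kappa] times the size of [F], hence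
   the [3]. Half of [eps] pays for them and half for [eta]. *)
have [n [n0 nP]] : exists n, (0 < n)%N /\ 3 * kappa <= eps / 2 * (1 + eta) ^+ n.
  pose a := 6 * kappa / eps / eta; exists (Num.truncn a).+1; split=> //.
  have : a <= (Num.truncn a).+1%:R by apply: ltW; exact: truncnS_gt.
  rewrite /a ler_pdivrMr // ler_pdivrMr // -/a => nk.
  by have := ler_wpM2l (ltW eps0) (bernoulli (Num.truncn a).+1 (ltW eta0)); lra.
exists n; split=> // F cF [F0 Fphi Fpsi].
have [Q QE] : exists Q, Q = 1 + eta by exists (1 + eta).
pose c i : R := Q ^+ (minn i (n.*2 - i)).
(* The index is shifted by [n]: term [i] lives where [phi] applied [i - n] times leads into [F], and
   [i = n] is the centre. *)
pose g k := \sum_(0 <= i < n.*2) c i * \1_F (iter n psi (iter i phi k)) : R.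
have [nn nc] : (n < n.*2)%N /\ minn n (n.*2 - n) = n by lia.
have [N2 nl] : n.*2 = n.*2.-1.+1 /\ minn n.*2.-1 (n.*2 - n.*2.-1) = 1%N by lia.
have Q1 : 1 <= Q by rewrite QE lerDl ltW.
have Q0 : 0 < Q by exact: lt_le_trans Q1.
have c0 i : 0 <= c i by rewrite exprn_ge0 // ltW.
have v0 k : 0 <= \1_F k :> R by rewrite indicE ler0n.
have lF i : lc (fun k => \1_F (iter n psi (iter i phi k)) : R).
  have -> : (fun k => \1_F (iter n psi (iter i phi k)) : R) =
      \1_(iter i phi @^-1` (iter n psi @^-1` F)).
    by apply/funext => k; rewrite !indicE.
  by apply: locally_constant_indic; do 2 apply: clopen_iter => //.
have lg : lc g.
  apply: locally_constant_sum => i.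
  by apply: (locally_constant_comp2 (fun a b => a * b)) (lF i); exact: locally_constant_cst.
have g0 k : 0 <= g k by rewrite sumr_ge0 // => i _; rewrite mulr_ge0.
have center : Q ^+ n * size_at F <= nrm (act m g x).
  rewrite -(@ger0_norm _ (Q ^+ n)) ?exprn_ge0 ?(ltW Q0) // -nrmZr -actZ //;
    last exact: locally_constant_indic.
  apply: act_mono => // [|k].
    apply: (locally_constant_comp2 (fun a b => a * b));
      [exact: locally_constant_cst|exact: locally_constant_indic].
  rewrite !ger0_norm ?g0 ?mulr_ge0 ?exprn_ge0 ?(ltW Q0) //.
  rewrite /g (bigD1_seq n) /= ?mem_index_iota ?iota_uniq //.
  rewrite (iter_cancel n phiK) /c nc.
  by rewrite lerDl sumr_ge0 // => i _; apply: mulr_ge0; [exact: c0|exact: v0].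
exists g; split=> //.
- by apply: lt_le_trans center; rewrite mulr_gt0 // exprn_gt0.
(* [E] bounds the variation of [g]: the interior part, the end [i = 0] of weight [1], and the end
   [i = 2n - 1] of weight [Q], whose shifted term sits on the preimage of [F] under [iter n phi]. *)
- pose E k := eta * g k + \1_(iter n psi @^-1` F) k + Q * \1_(iter n phi @^-1` F) k.
  have l1 : lc (\1_(iter n psi @^-1` F) : K -> R).
    by apply: locally_constant_indic; exact: clopen_iter.
  have l2 : lc (\1_(iter n phi @^-1` F) : K -> R).
    by apply: locally_constant_indic; exact: clopen_iter.
  have lZ a (f : K -> R) : lc f -> lc (fun k => a * f k).
    by move=> ?; apply: (locally_constant_comp2 (fun a b => a * b)) => //;
      exact: locally_constant_cst.
  have lD (f h : K -> R) : lc f -> lc h -> lc (fun k => f k + h k).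
    exact: (locally_constant_comp2 (fun a b => a + b)).
  have gE k : `|g (phi k) - g k| <= E k.
    pose v i : R := \1_F (iter n psi (iter i phi k)).
    have -> : g (phi k) = \sum_(0 <= i < n.*2) c i * v i.+1.
      by apply: eq_bigr => i _; rewrite /v iterSr.
    have cv i : (i < n.*2.-1)%N -> `|c i - c i.+1| <= eta * c i.+1.
      by rewrite /c QE => ?; apply: tower_weight_step => //; exact: ltW.
    have := @summation_by_parts_le R c v n.*2.-1 eta (ltW eta0) c0 (fun i => v0 _) cv.
    rewrite -N2 => /le_trans; apply; rewrite /E /g.
    have -> : c 0 = 1 by rewrite /c min0n expr0.
    have -> : c n.*2.-1 = Q by rewrite /c nl expr1.
    rewrite mul1r !lerD2l; apply: ler_wpM2l; first exact: ltW.
    by rewrite /v !indicE -addnn iterD (iter_cancel n phiK).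
  have lE : lc E by apply: (lD _ _ (lD _ _ (lZ _ _ lg) l1)); exact: lZ.
  apply: le_trans (act_mono (f := E) bm x lE _ _) _.
  + have lgp : lc (g \o phi) by exact: locally_constant_precomp.
    exact: (locally_constant_comp2 (fun a b => a - b) lgp lg).
  + by move=> k; apply: le_trans (gE k) _; exact: ler_norm.
  have -> : act m E x = eta%:C *: act m g x +
      act m (\1_(iter n psi @^-1` F)) x + Q%:C *: act m (\1_(iter n phi @^-1` F)) x.
    by rewrite -!actZ // -!actD //; [exact: (lD _ _ (lZ _ _ lg) l1)|exact: lZ|exact: lZ].
  apply: le_trans (nrmD _ _) _; rewrite nrmZr gtr0_norm //.
  apply: le_trans (lerD (nrmD _ _) (lexx _)) _; rewrite nrmZr gtr0_norm //.
  rewrite -/(size_at _) -/(size_at (iter n phi @^-1` F)).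
  have := ler_wpM2r (ltW F0) nP; have := nrm_ge0 (act m g x).
  move: center; rewrite -QE; set a := nrm _; set p := Q ^+ n; set s := size_at F.
  move=> center a0 ps.
  have := ler_wpM2l (ltW Q0) Fphi; have := ler_wpM2r a0 eta2.
  have : Q * (kappa * s) <= 2 * (kappa * s).
    by apply: ler_wpM2r; [rewrite mulr_ge0 // ltW|rewrite QE; lra].
  have e20 : 0 <= eps / 2 by lra.
  have := ler_wpM2l e20 center.
  by move: Fpsi; rewrite -/s; lra.
- move=> k gk; apply: contrapT => nF; move/eqP: gk; apply.
  rewrite /g big_nat big1 // => i /andP[_ iN]; rewrite indicE memNset ?mulr0 //.
  by rewrite /= iter_psi_phi // => Fi; apply: nF; exists i.
Qed.

End Eigenvector.

(** * Kaplansky modules *)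

Section Kaplansky.
Context {R : realType} {K : topologicalType} {X : completeNormedModType R[i]}.
Variable m : CK R K -> LX X.
Hypotheses (compactK : compact [set: K]) (hausK : hausdorff_space K)
  (kapX : kaplansky_module m).

(** By regularity [O] contains the closure of a neighbourhood [B]; the closure of the interior of
    [B] is open because [K] is extremally disconnected. *)
Lemma kaplansky_clopen_base (k : K) (O : set K) : open O -> O k ->
  exists A, [/\ clopen A, A k & A `<=` O].
Proof.
move=> oO Ok; have [_ ed _] := kapX.
have Onbhs : nbhs k O by apply: open_nbhs_nbhs.
have [B kB BO] := compact_regular hausK compactK (filterT : nbhs k setT) Onbhs.
exists (closure (interior B)); split.
- split; last exact: closed_closure.
  by apply: ed; exact: open_interior.
- exact: subset_closure.
- apply: subset_trans BO; apply: closureS; exact: interior_subset.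
Qed.

Let bm : banach_module m. Proof. by case: kapX. Qed.

(* Otherwise [1] would be the supremum of the indicators annihilating [y]. *)
Lemma kaplansky_support (y : X) : y <> 0 -> exists W : set K,
  [/\ open W, W !=set0 & forall G, clopen G -> G !=set0 -> G `<=` W ->
    act m (\1_G) y <> 0].
Proof.
move=> y0; apply: contrapT => nW; apply: y0.
have {}nW W : open W -> W !=set0 ->
    exists G, [/\ clopen G, G !=set0, G `<=` W & act m (\1_G) y = 0].
  move=> oW W0; apply: contrapT => nG; apply: nW; exists W; split=> // G cG G0 GW Gy.
  by apply: nG; exists G.
have [_ _ /(_ y)[_ _ _ lub]] := kapX.
rewrite -[LHS](module_one bm).
have indicC G k : clopen G -> to_CK (\1_G : K -> R) k = (\1_G k : R)%:C.
  by move=> cG; rewrite to_CKE //; exact: locally_constant_indic.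
apply: (lub [set f | exists G, [/\ clopen G, f = to_CK (\1_G) & act m (\1_G) y = 0]]).
- by move=> f [G [_ -> Gy]].
- by move=> f [G [cG -> _]] k; rewrite indicC // complex_real.
split=> [k|f [G [cG -> _]] k|t treal tub k]; first exact: real1.
  by rewrite indicC // -[leRHS]/((1 : R)%:C) lecR indicE lern1 leq_b1.
(* An upper bound [t] with [t k < 1] stays below [1] near [k], where some annihilating indicator
   takes the value [1]. *)
rewrite real_leNgt ?real1 //; apply/negP => tk.
pose D := [set k' | `|(t k : (R[i])^o) - t k'| < 1 - t k].
have Dk : nbhs k D.
  have ct := @cts_fun _ _ t k.
  by move/cvgrPdist_lt : ct; apply; rewrite subr_gt0.
have [oW Wk] := (@open_interior _ D, nbhs_singleton (nbhs_interior Dk)).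
have Wt := @interior_subset _ D.
have [G [cG [k' Gk'] GW Gy]] := nW _ oW (ex_intro _ k Wk).
have := tub (to_CK (\1_G)); rewrite /fun_le => /(_ _ k')/wrap[|].
  by exists G.
rewrite indicC // indicE mem_set //; apply/negP; rewrite -real_ltNge ?real1 //.
have : `|(t k : R[i]) - t k'| < 1 - t k := Wt k' (GW _ Gk').
rewrite distrC => /(le_lt_trans (real_ler_norm _)).
by rewrite ltrBDr subrK; apply; rewrite rpredB.
Qed.

Hypothesis no_isolated : isolated [set: K] = set0.

Lemma no_decay (x : X) (C : R) (Q : nat -> seq K) : x <> 0 ->
  ~ forall L A, clopen A -> (forall k, k \in Q L -> ~ A k) ->
      2 ^+ L * size_at m x A <= C.
Proof.
move=> x0 decay.
have decay' L A : clopen A -> (forall k, k \in Q L -> ~ A k) ->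
    size_at m x A <= C * 2^-1 ^+ L.
  by move=> cA /(decay L A cA); rewrite exprVn ler_pdivlMr ?exprn_gt0 // mulrC.
have xT : size_at m x setT = nrm x.
  by rewrite /size_at -[in RHS](act1 bm x) indicT.
have C0 : 0 <= C.
  have := decay 0 set0 clopen0 (fun _ _ => id).
  by rewrite size_at_set0 // mulr0.
have decay_lt (e : R) : 0 < e -> exists N, forall n, (N <= n)%N -> C * 2^-1 ^+ n < e.
  move=> e0; have C1 : 0 < C + 1 by lra.
  have [N NP] := exprV2_lt (divr_gt0 e0 C1); exists N => n /NP.
  rewrite ltr_pdivlMr //; have : 0 <= 2^-1 ^+ n :> R by rewrite exprn_ge0 // invr_ge0.
  by lra.
have cI A : clopen A -> locally_constant (\1_A : K -> R) by exact: locally_constant_indic.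
(* If sizes tended to [0] at every point, some clopen set containing [Q L] would have size below
   half of [nrm x]; for large [L] so would its complement, by decay. *)
have [k1 [c [c0 ck1]]] : exists k1 c, 0 < c /\
    forall A, clopen A -> A k1 -> c <= size_at m x A.
  apply: contrapT => nk.
  have small k c : 0 < c -> exists A, [/\ clopen A, A k & size_at m x A < c].
    move=> c0; apply: contrapT => nA; apply: nk; exists k, c; split=> // A cA Ak.
    by rewrite leNgt; apply/negP => Ac; apply: nA; exists A.
  have smalls (s : seq K) c : 0 < c ->
      exists A, [/\ clopen A, forall k, k \in s -> A k & size_at m x A < c].
    elim: s c => [|k s IHs] c c0.
      by exists set0; split=> //; [exact: clopen0|rewrite size_at_set0].
    have c20 : 0 < c / 2 by lra.
    have [A [cA As Ac]] := IHs _ c20; have [B [cB Bk Bc]] := small k _ c20.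
    exists (B `|` A); split; first exact: clopenU.
      by move=> k'; rewrite inE => /predU1P[->|/As]; [left|right].
    by apply: le_lt_trans (size_atU bm x cB cA) _; lra.
  have x2 : 0 < nrm x / 2 by have := nrm_gt0 x0; lra.
  have [L /(_ L (leqnn L)) CL] := decay_lt _ x2.
  have [A [cA AQ Ax]] := smalls (Q L) _ x2.
  have cA' : clopen (~` A) by exact: (@clopenC _ _ set0).
  have := size_atU bm x cA cA'; rewrite setUv xT.
  have := decay' L (~` A) cA' (fun k kQ nA => nA (AQ k kQ)).
  by lra.
(* [H L] isolates [k1] from the rest of [Q L]; the intersections [E L] moreover decrease. *)
have /choice[H HP] L : exists H, [/\ clopen H, H k1 &
    forall k, k \in Q L -> H k -> k = k1].
  have [V [cV [Vp VE]]] := clopen_separation kaplansky_clopen_base hausK (k1 :: Q L).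
  exists (V k1); split=> // k kQ Vk.
  by apply/esym/(VE _ _ k) => //; rewrite inE ?eqxx ?kQ ?orbT.
pose E L := [set z | forall i, (i < L.+1)%N -> H i z].
have cE L : clopen (E L) by apply: clopen_forall_lt => i; have [] := HP i.
have EH L : E L `<=` H L by move=> k; apply.
have Ek1 L : E L k1 by move=> i _; have [] := HP i.
have EQ L k : k \in Q L -> E L k -> k = k1.
  by move=> kQ /EH; have [_ _] := HP L; apply.
pose u L := act m (\1_(E L)) x.
have uD L : u L - u L.+1 = act m (\1_(E L `\` E L.+1)) x.
  apply/eqP; rewrite subr_eq /u -actD //; try by apply: cI => //; exact: clopenD.
  apply/eqP; congr act; apply/funext => k; rewrite !indicE in_setD.
  have [Ek|nEk] := boolP (k \in E L.+1); rewrite ?andbF ?andbT ?add0r ?addr0 //.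
  rewrite mem_set // => i iL; move/set_mem : Ek; apply; exact: ltnW.
(* [E L] minus [E L.+1] avoids [Q L]: the only possible point is [k1], which is in both sets. *)
have [|y uy] := @geometric_cvg R X u C.
  move=> L; rewrite nrmBC uD; apply: decay'; first exact: clopenD.
  by move=> k kQ [Ek nE]; apply: nE; rewrite (EQ _ _ kQ Ek).
have y0 : y <> 0.
  move=> y0; move/cvg_nrmP : uy => /(_ c c0)[N /(_ N (leqnn N))].
  rewrite y0 subr0; apply/negP; rewrite -leNgt; exact: ck1.
have [W [oW [k0 Wk0] Wy]] := kaplansky_support y0.
(* Otherwise the open set [W] would be the single point [k1], which would be isolated. *)
have [k Wk kk1] : exists2 k, W k & k <> k1.
  apply: contrapT => /forall2NP Wk1.
  have WE k : W k -> k = k1 by move=> Wk; have [//|/contrapT] := Wk1 k.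
  suff : isolated [set: K] k1 by rewrite no_isolated.
  split; first by rewrite inE.
  exists W; first by apply: open_nbhs_nbhs; split=> //; rewrite -(WE _ Wk0).
  rewrite setIT predeqE => k; split=> [/WE//|->]; by rewrite -(WE _ Wk0).
have [A [cA Ak nAk1]] := clopen_neighbourhood kaplansky_clopen_base hausK kk1.
have [B [cB Bk BW]] := kaplansky_clopen_base oW Wk.
have cG : clopen (A `&` B) by exact: clopenI.
apply: (Wy (A `&` B)) => //; [by exists k|by move=> z [_ /BW]|].
apply: nrm0_eq0; apply/eqP; rewrite eq_le nrm_ge0 andbT.
apply/ler_addgt0Pr => e e0; rewrite add0r.
have e20 : 0 < e / 2 by lra.
move/cvg_nrmP : uy => /(_ _ e20)[N1 N1P]; have [N2 N2P] := decay_lt _ e20.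
pose L := maxn N1 N2.
(* [A] excludes [k1], the only point of [Q L] that can be in [E L], so decay applies to the product
   of the indicators. *)
have Gu : nrm (act m (\1_(A `&` B)) (u L)) <= C * 2^-1 ^+ L.
  rewrite /u -actM //; try exact: cI.
  have -> : (fun z => \1_(A `&` B) z * \1_(E L) z : R) = \1_(A `&` B `&` E L).
    by apply/funext => z; rewrite !indicE !in_setI -natrM mulnb.
  apply: decay'; first exact: clopenI.
  by move=> z zQ [[Az _] Ez]; apply: nAk1; rewrite -(EQ _ _ zQ Ez).
have Gy : nrm (act m (\1_(A `&` B)) (y - u L)) <= nrm (y - u L).
  rewrite -[leRHS]mul1r; apply: act_le => //; first exact: cI.
  by move=> z; rewrite indicE ger0_norm ?ler0n // lern1 leq_b1.
have := nrmD (act m (\1_(A `&` B)) (y - u L)) (act m (\1_(A `&` B)) (u L)).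
have -> : act m (\1_(A `&` B)) (y - u L) + act m (\1_(A `&` B)) (u L) =
    act m (\1_(A `&` B)) y by rewrite /act -linearD subrK.
have := N1P L (leq_maxl _ _); have := N2P L (leq_maxr _ _); rewrite (nrmBC (u L)).
by lra.
Qed.

End Kaplansky.

(** * Equality of the two spectra *)

Unset Implicit Arguments.

Theorem theorem5p9 (R : realType) (K : topologicalType)
  (X : completeNormedModType R[i]) (m : CK R K -> LX X)
  (compactK : compact [set: K]) (hausdorffK : hausdorff_space K)
  (kaplanskyX : kaplansky_module m)
  (U V : LX X) (isoU : d_isomorphism m U V)
  (specU : spectrum U `<=` [set l : R[i] | `|l| = 1])
  (w : CK R K)
  (phi : continuousType K K) (homeo_phi : homeomorphism phi)
  (phiE : forall (f : CK R K) (x : X),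
    U (m f (V x)) = m (f \o phi : CK R K) x)
  (aperiodic : periodic_points phi = set0)
  (no_isolated : isolated [set: K] = set0) :
  sigma_2 (m w \o U) = sigma_ap (m w \o U).
Proof.
have [bm _ _] := kaplanskyX; have [_ _ [UK VK]] := isoU.
have [psi [phiK psiK]] := homeo_phi.
have cphi : continuous phi by exact: cts_fun.
have cpsi : continuous psi by exact: cts_fun.
have base := kaplansky_clopen_base compactK hausdorffK kaplanskyX.
have aper n k : (0 < n)%N -> iter n phi k <> k.
  move=> n0 nk; have : periodic_points phi k by exists n.
  by rewrite aperiodic.
pose T : X -> X := m w \o U.
(* Insert [V U] before [y]: conjugation by [U] turns [f] into [f \o phi], which commutes with
   [w]. *)
have T_act f y : locally_constant f -> T (act m f y) = act m (f \o phi) (T y).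
  move=> lf; rewrite /T /= /act -{1}(UK y) phiE -!(module_mul bm).
  apply: module_ext => k /=; rewrite mulrC to_CKE //; last exact: locally_constant_precomp.
  by rewrite to_CKE.
have [Mw Mw0 wM] := bounded_linear_nrm (m w); have [MU MU0 UM] := bounded_linear_nrm U.
have SB l : {morph shift_op l T : x y / x - y}.
  move=> x y; rewrite /shift_op /T /= (linearB U) (linearB (m w)) scalerBr.
  by rewrite !opprD !opprK addrACA.
have SZ l c : {morph shift_op l T : x / c *: x}.
  move=> x; have TZ : T (c *: x) = c *: T x by rewrite /T /= !linearZ.
  by rewrite /shift_op TZ scalerBr !scalerA mulrC.
have SM l x : nrm (shift_op l T x) <= (complex.Re `|l| + Mw * MU) * nrm x.
  rewrite mulrDl; apply: le_trans (nrmB _ _) _; rewrite nrmZ lerD2l -mulrA.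
  by apply: le_trans (wM _) _; rewrite ler_pM2l.
rewrite -/T; apply/seteqP; split=> l.
  by move=> /= nF; apply: contrapT => nap; apply: nF; exact: (not_ap_fredholm (SB l) (SZ l) (SM l) erefl).
move=> ap /= usf.
have [x x0 Sx] := fredholm_ap_kernel (SB l) (SZ l) (SM l) erefl usf ap.
have Tx : T x = l *: x by apply/esym/subr0_eq.
have [d [eps [d0 eps0 bound]]] := almost_kernel_bound (SB l) (SZ l) (SM l) usf.
have l0 : 0 <= complex.Re `|l| by rewrite -lecR -normc_real; exact: normr_ge0.
have l1 : 0 < complex.Re `|l| + 1 by lra.
(* The defect of [g x] is [|l|] times the variation of [g]; dividing by [|l| + 1] keeps it within
   [eps], also when [l = 0]. *)
have [|n [n0 towers]] := @slow_tower R K X m phi psi bm cphi cpsi phiK psiK x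
  (d%:R *+ 4) (eps / (complex.Re `|l| + 1)) _ (divr_gt0 eps0 l1).
  by rewrite mulrn_wge0.
(* Taken with [r = d]. The decay it yields contradicts [no_decay]; it remains to refute [d] good
   sets with disjoint towers. *)
have := small_away_from_orbits compactK hausdorffK base cphi cpsi phiK psiK aper
  (size_at_set0 bm x) (size_at_mono bm x) (size_atU bm x) n0 d0 _ (size_at_le bm x).
case=> [F FP disj|C [Q [_]]]; last exact: (no_decay compactK hausdorffK).
have /choice[g gP] (i : 'I_d) := let: conj cF gF := FP i (ltn_ord i) in towers (F i) cF gF.
apply: (bound (fun i => act m (g i) x)) => [i|i|i c].
- by have [] := gP i.
- have [lg _ slow _] := gP i; rewrite (shift_op_act bm cphi T_act Tx lg).
  apply: le_trans (ler_wpM2l l0 slow) _; rewrite mulrA ler_wpM2r ?nrm_ge0 //.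
  by rewrite mulrCA ger_pMr // ler_pdivrMr // mul1r lerDl.
(* The indicator of the support of [g i] annihilates the other [g j] and acts with norm at most [1],
   so it extracts the [i]-th term of a combination without increasing the norm. *)
pose h k : R := if g i k == 0 then 0 else 1.
have lh : locally_constant h.
  have [lg _ _ _] := gP i.
  exact: (locally_constant_comp2 (fun a b : R => if a == 0 then 0 else 1) lg lg).
have h_g j : act m h (act m (g j) x) = if j == i then act m (g i) x else 0.
  have [lg _ _ supg] := gP j; rewrite -actM //; case: eqP => [->|ji].
    congr act; apply/funext => k; rewrite /h; case: eqP => [->|]; by rewrite ?mulr0 ?mul1r.
  rewrite -(act0 bm x); congr act; apply/funext => k; rewrite /h.
  have [_|gi] := eqVneq (g i k) 0; first by rewrite mul0r.
  have [->|gj] := eqVneq (g j k) 0; first by rewrite mulr0.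
  have [_ _ _ supi] := gP i.
  have [s sn Fs] := supi k gi; have [t tn Ft] := supg k gj.
  have ij : nat_of_ord i <> j by move=> /ord_inj E; apply: ji.
  (* A common point [k] of the supports would put [iter n psi k] into both towers. *)
  by case: (disj i j (ltn_ord i) (ltn_ord j) ij s t _ sn tn Fs Ft).
have -> : c i *: act m (g i) x = act m h (\sum_j c j *: act m (g j) x).
  rewrite /act linear_sum /= (bigD1 i) //= big1 => [|j ji].
    by rewrite addr0 linearZ /= -/(act m (g i) x) -/(act m h _) h_g eqxx.
  by rewrite linearZ /= -/(act m (g j) x) -/(act m h _) h_g (negPf ji) scaler0.
rewrite -[leRHS]mul1r; apply: act_le => // k.
by rewrite /h; case: ifP => _; rewrite ?normr0 ?normr1.
Qed.
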